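(* Suppose $A$ is a semiprime Zariski-closed $F$-subalgebra of $B$. Then $A$ is semisimple, namely isomorphic to a direct product of (finitely many) matrix algebras over fields.
   Context: $F\subseteq K$ are fields, $F$ finite or infinite, $K$ algebraically closed; $B$ is a finite dimensional $K$-algebra, and $n=\dim_K B$. Choosing a $K$-base of $B$, identify $B$ with the affine space $K^{n}$ and give it the Zariski topology (closed sets are the common zero sets of subsets of $K[\lambda_1,\dots,\lambda_n]$; this does not depend on the base). An $F$-subalgebra $A\subseteq B$ is Zariski-closed if it is a closed subset of $B$. Every nil ideal of such an $A$ is nilpotent, and $A$ is semiprime if and only if it has no nonzero nilpotent ideals. *)

(* Defs.v *)
From mathcomp Require Import all_boot all_order all_algebra.
From mathcomp Require Import boolp classical_sets.
From mathcomp Require Import mpoly.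

Set Implicit Arguments.
Unset Strict Implicit.
Unset Printing Implicit Defensive.

Import GRing.Theory.
Local Open Scope ring_scope.

(* A finite dimensional associative K-algebra, possibly without unit, is given
   by a [vectType K] B together with an associative bilinear product
   [mul : {bilinear B -> B -> B}].  The inclusion of F in K is a ring morphism
   [iota : {rmorphism F -> K}]. *)

(* B is identified with K^n through the coordinates in the base e. *)
Definition zariski_closed (K : fieldType) (B : vectType K) (n : nat)
    (e : n.-tuple B) (A : set B) : Prop :=
  exists S : set {mpoly K[n]},
    A = [set x | forall p, S p -> p.@[fun i => coord e i x] = 0]%classic.

Section Subalgebras.

Variables (F K : fieldType) (iota : {rmorphism F -> K}).
Variables (B : vectType K) (mul : {bilinear B -> B -> B}).

Definition subspaceF (V : set B) : Prop :=
  [/\ V 0,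
      forall x y, V x -> V y -> V (x + y) &
      forall (a : F) x, V x -> V (iota a *: x)].

Definition subalgebraF (A : set B) : Prop :=
  subspaceF A /\ forall x y, A x -> A y -> A (mul x y).

Definition two_sided_ideal (A I : set B) : Prop :=
  [/\ (I `<=` A)%classic,
      subspaceF I,
      forall a x, A a -> I x -> I (mul a x) &
      forall a x, A a -> I x -> I (mul x a)].

(* Without a unit, powers are taken over nonempty words: the condition below
   says that I^(m+1) = 0. *)
Definition nilpotent_set (I : set B) : Prop :=
  exists m : nat, forall (x : B) (s : seq B),
    size s = m -> I x -> (forall y, y \in s -> I y) -> foldl mul x s = 0.

Definition semiprimeF (A : set B) : Prop :=
  forall I : set B, two_sided_ideal A I -> nilpotent_set I -> I = [set 0]%classic.

(* The map x |-> (phi i x)_i restricts to an isomorphism of F-algebras from A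
   onto the product of the 'M[L i]_(d i), where L i is an F-algebra through
   emb i.  The values of phi outside A are irrelevant. *)
Definition matrix_product_iso (A : set B) (r : nat) (d : 'I_r -> nat)
    (L : 'I_r -> fieldType) (emb : forall i, {rmorphism F -> L i})
    (phi : forall i, B -> 'M[L i]_(d i)) : Prop :=
  [/\ forall i x y, A x -> A y -> phi i (x + y) = phi i x + phi i y,
      forall i (a : F) x, A x -> phi i (iota a *: x) = emb i a *: phi i x,
      forall i x y, A x -> A y -> phi i (mul x y) = phi i x *m phi i y,
      forall x y, A x -> A y -> (forall i, phi i x = phi i y) -> x = y &
      forall M : forall i, 'M[L i]_(d i),
        exists2 x, A x & forall i, phi i x = M i].

(* The empty product (r = 0) is allowed: it is the zero algebra. *)
Definition semisimpleF (A : set B) : Prop :=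
  exists (r : nat) (d : 'I_r -> nat) (L : 'I_r -> fieldType)
         (emb : forall i, {rmorphism F -> L i})
         (phi : forall i, B -> 'M[L i]_(d i)),
    (forall i, (0 < d i)%N) /\ matrix_product_iso A emb phi.

End Subalgebras.

(* Main.v *)
From HB Require Import structures.
Require Import Defs.
From mathcomp Require Import all_boot all_order all_algebra.
From mathcomp Require Import cyclic finfield.
From mathcomp Require Import boolp classical_sets.
From mathcomp Require Import mpoly.

Set Implicit Arguments.
Unset Strict Implicit.
Unset Printing Implicit Defensive.

Import GRing.Theory.
Local Open Scope ring_scope.

(** The right regular representation of the unitization of [B] turns [A] into
    a closed subring, possibly without unit, of a matrix algebra over [K].
    Everything then rests on one observation, [zclosed_stable_inv]: if an
    invertible matrix [g] maps a closed set [S] into itself, so does its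
    inverse.

    Applied to left multiplication on a Fitting component, this shows that [A]
    contains the Fitting idempotent [e] of each of its elements [x], together
    with an inverse of a power of [x] relative to [e] ([closed_idempotent]).
    If [A] is semiprime, an element of minimal rank shows that no left ideal
    generated by a nonzero element is nil, so each of them contains a nonzero
    idempotent.  Hence [A] behaves like a semisimple artinian ring: its
    identity is a finite sum of orthogonal primitive idempotents [e i], the
    corners [e i * A * e i] are division rings, and the nonzero elements of
    [e i * A * e j] are invertible.  The matrix units that this produces give
    the isomorphism with a product of matrix algebras over the corners
    ([closed_semiprime_structure]).

    It remains to see that a closed division ring [D] of matrices is
    commutative ([closed_division_comm]).
    - In characteristic 0, closedness and additivity make [D] a [K]-subspace;
      evaluating the split characteristic polynomial of [x] in the domain [D]
      gives a zero factor [x - c e], so [D] consists of the multiples of its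
      unit.
    - In characteristic [p], let [x] have infinite multiplicative order.  Some
      power of [x] is diagonalizable; in a basis of eigenvectors, the diagonal
      matrices in [D] form a closed field [C], and the diagonal entries are
      ring morphisms from [C] to [K].  Entries that are not powers of one
      another are algebraically independent
      ([characters_algebraically_independent]), so the closed set [C] would
      contain all tuples of values of such entries, including zero divisors.
      Therefore [C] consists of the diagonal matrices with entries [t ^+ b i],
      for fixed positive exponents [b i] and [t] ranging over all of [K].  An
      element of [D] with smallest nonempty support among the positions with
      [b i != b j] is homogeneous of nontrivial weight, hence nilpotent, which
      is absurd; so [C] is central, and comparing Frobenius powers puts [x]
      in [C].
    - If all nonzero elements have finite order, Jacobson's argument applies:
      two elements that do not commute would yield [x] and [d] with
      [d * x = x ^+ k * d] and [x ^+ k != x]; these generate a finite division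
      ring, contradicting Wedderburn's theorem. *)

(** * Closed sets and translation by an invertible matrix *)

(** Polynomial functions without coordinates: this keeps closedness stable under
    linear changes of variables, and allows induction on the function. *)
Inductive polyfun (K : fieldType) (V : lmodType K) : (V -> K) -> Prop :=
| polyfun_const c : polyfun (fun=> c)
| polyfun_linear f : scalar f -> polyfun f
| polyfunD f g : polyfun f -> polyfun g -> polyfun (fun x => f x + g x)
| polyfunM f g : polyfun f -> polyfun g -> polyfun (fun x => f x * g x).

(** A set is closed when it contains every common zero of the polynomial
    functions that vanish on it. *)
Definition zclosed (K : fieldType) (V : lmodType K) (A : set V) : Prop :=
  forall x, (forall f, polyfun f -> (forall a, A a -> f a = 0) -> f x = 0) -> A x.

Section PolynomialFunctions.
Variable K : fieldType.

Lemma polyfun_comp (U V : lmodType K) (h : {linear U -> V}) (f : V -> K) :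
  polyfun f -> polyfun (fun x => f (h x)).
Proof.
elim=> [c|{}f flin|{}f g _ pf _ pg|{}f g _ pf _ pg].
- exact: polyfun_const.
- by apply: polyfun_linear => a u v; rewrite linearP flin.
- exact: polyfunD.
- exact: polyfunM.
Qed.

Lemma zclosed_preimage (U V : lmodType K) (h : {linear U -> V}) (A : set V) :
  zclosed A -> zclosed [set x | A (h x)]%classic.
Proof.
move=> clA x xcl; apply: clA => f pf f0.
by apply: (xcl (fun y => f (h y))) => [|a]; [apply: polyfun_comp|apply: f0].
Qed.

Lemma zclosedI (V : lmodType K) (A B : set V) :
  zclosed A -> zclosed B -> zclosed (A `&` B)%classic.
Proof.
move=> clA clB x xcl; split.
  by apply: clA => f pf f0; apply: xcl => // a [Aa _]; apply: f0.
by apply: clB => f pf f0; apply: xcl => // a [_ Ba]; apply: f0.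
Qed.

Lemma zclosed_kernel (V : lmodType K) m n (h : {linear V -> 'M[K]_(m, n)}) :
  zclosed [set x | h x = 0]%classic.
Proof.
move=> x xcl; apply/matrixP => i j; rewrite mxE.
apply: (xcl (fun y => h y i j)) => [|a /= ->]; last by rewrite mxE.
by apply: polyfun_linear => a u v; rewrite linearP !mxE.
Qed.

Lemma horner_mx_sum n (T : 'M[K]_n.+1) (q : {poly K}) :
  horner_mx T q = \sum_(i < size q) q`_i *: T ^+ i.
Proof.
rewrite -[in LHS](coefK q) poly_def raddf_sum; apply: eq_bigr => i _.
by rewrite /= linearZ rmorphXn /= horner_mx_X.
Qed.

(** Left multiplication by [g] acts locally finitely on polynomial functions: [f]
    factors linearly through a vector [F] of functions on which [g] acts by a
    matrix [T].  For products, [F] is the vector of all products of entries. *)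
Lemma polyfun_orbit_finite n (g : 'M[K]_n) (f : 'M[K]_n -> K) : polyfun f ->
  exists m (F : 'M[K]_n -> 'rV[K]_m) (T : 'M[K]_m) (c : 'cV[K]_m),
    (forall x, F (g *m x) = F x *m T) /\ (forall x, f x = (F x *m c) 0 0).
Proof.
elim=> {f} [a|f flin|f1 f2 _ [m1 [F1 [T1 [c1 [F1g f1E]]]]] _ [m2 [F2 [T2 [c2 [F2g f2E]]]]]
  |f1 f2 _ [m1 [F1 [T1 [c1 [F1g f1E]]]]] _ [m2 [F2 [T2 [c2 [F2g f2E]]]]]].
- exists 1%N, (fun=> 1%:M), 1%:M, (const_mx a).
  by split=> x; rewrite ?mulmx1 // mul1mx mxE.
- exists (n * n)%N, (fun x => mxvec x), (lin_mulmx g), (\col_k f (vec_mx (delta_mx 0 k))).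
  split=> x; first by rewrite /lin_mulmx mul_vec_lin.
  pose f' : {linear 'M[K]_n -> K^o} := HB.pack f (GRing.isLinear.Build _ _ _ _ f flin).
  rewrite mxE -[in LHS](mxvecK x) [in LHS](row_sum_delta (mxvec x)).
  rewrite linear_sum -[f]/(f' : _ -> _) linear_sum; apply: eq_bigr => k _.
  by rewrite !linearZ mxE.
- exists (m1 + m2)%N, (fun x => row_mx (F1 x) (F2 x)), (block_mx T1 0 0 T2), (col_mx c1 c2).
  split=> x; first by rewrite mul_row_block !mulmx0 addr0 add0r F1g F2g.
  by rewrite mul_row_col mxE f1E f2E.
- exists (m1 * m2)%N, (fun x => mxvec ((F1 x)^T *m F2 x)),
    (lin_mx (mulmxr T2 \o mulmx T1^T)), (mxvec (c1 *m c2^T))^T.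
  split=> x.
    by rewrite mul_vec_lin /= F1g F2g trmx_mul !mulmxA.
  rewrite -[c1]trmxK mxvec_dotmul trmxK mulmxA -mulmxA -trmx_mul.
  by rewrite [RHS]mxE big_ord1 [in X in _ = _ * X]mxE f1E f2E.
Qed.

(** Let [f] vanish on [S].  By local finiteness the functions [x |-> f (g^k x)]
    satisfy a linear recurrence with constant coefficients.  Since [g] is
    invertible, the recurrence may be shifted so that its lowest nonzero
    coefficient multiplies [f (g^-1 x)], while the other terms are values of [f]
    on the orbit of [x], which stays in [S].  Hence [f (g^-1 x) = 0]. *)
Lemma zclosed_stable_inv n (S : set 'M[K]_n) (g : 'M[K]_n) :
  zclosed S -> g \in unitmx -> (forall x, S x -> S (g *m x)) ->
  forall x, S x -> S (invmx g *m x).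
Proof.
move=> clS ug gS x Sx; apply: clS => f pf f0.
have [[|m] [F [T [c [Fg fE]]]]] := polyfun_orbit_finite g pf.
  by rewrite fE (flatmx0 c) mulmx0 mxE.
have gkS k y : S y -> S (iter k (mulmx g) y) by elim: k => //= k IH /IH /gS.
have Fgk k y : F (iter k (mulmx g) y) = F y *m T ^+ k.
  elim: k => [|k IH]; first by rewrite expr0 mulmx1.
  by rewrite iterS Fg IH exprSr mulmxA.
(* The factor 'X^r of the characteristic polynomial is absorbed by replacing x
   with its r-th preimage under g. *)
have [r [q q0 pE]] := multiplicity_XsubC (char_poly T) 0.
rewrite (monic_neq0 (char_poly_monic T)) /= subr0 in q0 pE.
have qT y : F (iter r (mulmx g) y) *m horner_mx T q = 0.
  rewrite Fgk -mulmxA -[T ^+ r *m _]/(T ^+ r * _).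
  have -> : T ^+ r = horner_mx T 'X^r by rewrite rmorphXn /= horner_mx_X.
  have := Cayley_Hamilton T; rewrite pE mulrC rmorphM /= => E.
  by rewrite E mulmx0.
have gK k y : iter k (mulmx g) (iter k (mulmx (invmx g)) y) = y.
  elim: k y => // k IH y; rewrite iterSr iterS mulmxA mulmxV // mul1mx; exact: IH.
have := qT (iter r (mulmx (invmx g)) (invmx g *m x)); rewrite gK.
have [q' qE] : exists q', q = q.[0]%:P + 'X * q'.
  exists ((q - q.[0]%:P) %/ 'X).
  rewrite -[LHS](subrK q.[0]%:P) addrC; congr (_ + _); rewrite mulrC; apply/esym/divpK.
  by rewrite -['X]subr0 -polyC0 dvdp_XsubCl rootE !hornerE subrr.
rewrite {1}qE rmorphD rmorphM /= horner_mx_C horner_mx_X mulmxDr.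
rewrite -[T * _]/(T *m _) mul_mx_scalar mulmxA -Fg mulmxA mulmxV // mul1mx.
move/(congr1 (fun v => (v *m c) 0 0)).
rewrite mulmxDl -scalemxAl mul0mx [RHS]mxE mxE [X in X + _]mxE -fE.
rewrite horner_mx_sum mulmx_sumr mulmx_suml summxE big1 ?addr0 => [/eqP|i _].
  by rewrite mulf_eq0 -[_ == 0]/(root q 0) (negPf q0) => /eqP.
by rewrite -scalemxAr -scalemxAl mxE -Fgk -fE f0 ?mulr0 //; apply: gkS.
Qed.

End PolynomialFunctions.

(** * Algebraic independence of characters in characteristic p *)

Lemma poly_vanishing0 (K : closedFieldType) (p : {poly K}) :
  (forall t, p.[t] = 0) -> p = 0.
Proof.
move=> p0; have : size (p + 1) == 1%N.
  apply/negPn/negP => /closed_rootP [x]; rewrite rootE !hornerE p0 add0r.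
  by rewrite oner_eq0.
move=> /size_poly1P [c _ pc].
have {}pc : p = (c - 1)%:P by rewrite polyCB -pc addrK.
by have := p0 0; rewrite pc hornerC => ->.
Qed.

Lemma exprn_fun_inj (K : closedFieldType) (a b : nat) :
  (forall t : K, t ^+ a = t ^+ b) -> a = b.
Proof.
move=> tab; have : 'X^a - 'X^b = 0 :> {poly K}.
  by apply: poly_vanishing0 => t; rewrite !hornerE tab subrr.
move/eqP; rewrite subr_eq0 => /eqP/(congr1 (size : {poly K} -> nat)).
by rewrite !size_polyXn => - [].
Qed.

(** The coefficient of ['X] in [('X + 1)^a] is [a]. *)
Lemma additive_expn (K : closedFieldType) (a : nat) :
  (forall t u : K, (t + u) ^+ a = t ^+ a + u ^+ a) -> a = 1%N \/ a%:R = 0 :> K.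
Proof.
case: a => [|[|a]] add_a; [by right|by left|right].
have : \poly_(i < a.+3) ('C(a.+2, i)%:R) - 'X^(a.+2) - 1 = 0 :> {poly K}.
  apply: poly_vanishing0 => t; rewrite !hornerE horner_poly.
  under eq_bigr do rewrite mulr_natl.
  by rewrite -exprD1n add_a expr1n addrAC addrK subrr.
by move/(congr1 (fun q : {poly K} => q`_1)); rewrite !coefE /= bin1 !subr0.
Qed.

(** The setting: [C] is a subring with unit [e], and the [chi i] are ring morphisms
    from [C] to [K] of which none is a power of another, and none is annihilated by
    a binomial ['X^a - 'X^b].  As in Artin's theorem on the algebraic independence
    of automorphisms, a relation between them is reduced
    first to an equality of two monomials and then to an additive one. *)
Section AlgebraicIndependence.

Variables (R : nzRingType) (K : closedFieldType) (p : nat).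
Hypothesis charp : p \in [pchar K].
Variables (C : set R) (e : R) (s : nat) (chi : 'I_s -> R -> K).
Hypothesis Ce : C e.
Hypothesis CD : forall x y, C x -> C y -> C (x + y).
Hypothesis CM : forall x y, C x -> C y -> C (x * y).
Hypothesis chi1 : forall i, chi i e = 1.
Hypothesis chiD : forall i x y, C x -> C y -> chi i (x + y) = chi i x + chi i y.
Hypothesis chiM : forall i x y, C x -> C y -> chi i (x * y) = chi i x * chi i y.
Hypothesis chi_inf : forall i a b,
  (forall x, C x -> chi i x ^+ a = chi i x ^+ b) -> a = b.
Hypothesis chi_rel : forall i j b,
  (forall x, C x -> chi i x = chi j x ^+ b) -> i = j.

Let ev (m : 'X_{1..s}) (v : 'I_s -> K) : K := \prod_i v i ^+ m i.
Let pt (x : R) := fun i => chi i x.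

Let evX m v : ('X_[m] : {mpoly K[s]}).@[v] = ev m v.
Proof. exact: mevalX. Qed.

Let same (m m' : 'X_{1..s}) := forall x, C x -> ev m (pt x) = ev m' (pt x).

Let meval_scaled (f : {mpoly K[s]}) c x : C c -> C x ->
  (\sum_(m <- msupp f) (f@_m * ev m (pt c)) *: 'X_[m]).@[pt x] = f.@[pt (c * x)].
Proof.
move=> Cc Cx; rewrite raddf_sum /= mevalE; apply: eq_bigr => m _.
rewrite mevalZ evX -mulrA; congr (_ * _); rewrite /ev -big_split /=.
by apply: eq_bigr => i _; rewrite /pt chiM // exprMn.
Qed.

(** Dedekind's argument: if [f] vanishes on [C], so does the difference of
    [x |-> f (c x)] and of [f] times the value at [c] of one of its monomials;
    this difference has fewer terms. *)
Lemma distinct_monomials_independent (N : nat) :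
  (forall m m' : 'X_{1..s}, (mdeg m < N)%N -> (mdeg m' < N)%N ->
    same m m' -> m = m') ->
  forall f : {mpoly K[s]}, (msize f <= N)%N ->
    (forall x, C x -> f.@[pt x] = 0) -> f = 0.
Proof.
move=> dist f; have [k] := ubnP (size (msupp f)).
elim: k f => // k IH f; rewrite ltnS => fk fN f0; apply/eqP/negP => /negP nf.
pose m := mlead f; have mf : m \in msupp f by exact: mlead_supp.
have sub m' : m' \in msupp f -> m' = m.
  move=> m'f; apply: dist => //.
  - by apply: leq_trans fN; apply: msize_mdeg_lt.
  - by apply: leq_trans fN; apply: msize_mdeg_lt.
  move=> c Cc.
  pose g := \sum_(l <- msupp f) (f@_l * (ev l (pt c) - ev m (pt c))) *: 'X_[l]
     : {mpoly K[s]}.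
  have gc l : g@_l = f@_l * (ev l (pt c) - ev m (pt c)).
    rewrite /g raddf_sum /=; have [lf|lf] := boolP (l \in msupp f).
      rewrite (bigD1_seq l) ?msupp_uniq //= mcoeffZ mcoeffX eqxx mulr1 big1 ?addr0 //.
      by move=> l' nl; rewrite mcoeffZ mcoeffX (negPf nl) mulr0.
    rewrite (memN_msupp_eq0 lf) mul0r big_seq big1 // => l' l'f.
    rewrite mcoeffZ mcoeffX; case: eqP => [E|]; last by rewrite mulr0.
    by rewrite -E l'f in lf.
  have gsub l : l \in msupp g -> l \in msupp f /\ l != m.
    rewrite !mcoeff_msupp gc => nz; split.
      by apply: contraNneq nz => ->; rewrite mul0r.
    by apply: contraNneq nz => ->; rewrite subrr mulr0.
  have g0 : g = 0.
    apply: IH.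
    - apply: leq_trans fk; rewrite (perm_size (perm_to_rem mf)) /=.
      rewrite ltnS; apply: uniq_leq_size; first exact: msupp_uniq.
      by move=> l /gsub [lf lm]; rewrite (rem_filter _ (msupp_uniq f)) mem_filter /= lm.
    - apply: leq_trans fN; rewrite !msizeE.
      apply/bigmax_leqP_seq => l /gsub [lf _] _.
      by rewrite -msizeE; apply: msize_mdeg_lt.
    - move=> x Cx; have -> : g.@[pt x] = f.@[pt (c * x)] - ev m (pt c) * f.@[pt x].
        rewrite -(@meval_scaled f c x) // [in X in _ - X]mevalE.
        rewrite /g !raddf_sum /= mulr_sumr -sumrB; apply: eq_bigr => l _.
        rewrite !mevalZ evX mulrBr mulrBl; congr (_ - _).
        by rewrite mulrA [_ * f@_l]mulrC.
      by rewrite !f0 ?mulr0 ?subr0 //; apply: CM.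
  move/(congr1 (mcoeff m')): g0; rewrite gc mcoeff0 => /eqP.
  rewrite mulf_eq0 -[f@_m' == 0]negbK -mcoeff_msupp m'f /= subr_eq0.
  by move/eqP.
have fE : f = f@_m *: 'X_[m].
  apply/mpolyP => l; rewrite mcoeffZ mcoeffX eq_sym.
  case: eqP => [->|lm]; first by rewrite mulr1.
  by rewrite mulr0 memN_msupp_eq0 //; apply: contra_notN lm => /sub.
have := f0 e Ce; rewrite fE mevalZ evX /ev big1 ?mulr1; last first.
  by move=> i _; rewrite /pt chi1 expr1n.
by move/eqP; rewrite mcoeff_eq0 mf.
Qed.

(** Agreement of [q] with [g] up to terms of degree less than [d]; degrees add under
    products. *)
Let lead_part (d : nat) (g q : {mpoly K[s]}) :=
  (msize g <= d.+1)%N /\ (msize (q - g) <= d)%N.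

Let lead_partM d d' g g' q q' :
  lead_part d g q -> lead_part d' g' q' -> lead_part (d + d') (g * g') (q * q').
Proof.
move=> [gd qd] [gd' qd'].
have bM a b (u v : {mpoly K[s]}) : (msize u <= a)%N -> (msize v <= b.+1)%N ->
   (msize (u * v) <= a + b)%N.
  move=> ua vb; have [->|u0] := eqVneq u 0; first by rewrite mul0r msize0.
  have [->|v0] := eqVneq v 0; first by rewrite mulr0 msize0.
  by rewrite msizeM //; have := leq_add ua vb; rewrite addnS; case: (msize u + _)%N.
have q'd : (msize q' <= d'.+1)%N.
  rewrite -[q'](subrK g'); apply: leq_trans (msizeD_le _ _) _.
  by rewrite geq_max gd' (leq_trans qd').
split; first by rewrite -addSn; apply: bM.
have -> : q * q' - g * g' = (q - g) * q' + (q' - g') * g.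
  by rewrite mulrBl [(q' - g') * g]mulrC mulrBr addrA subrK.
apply: leq_trans (msizeD_le _ _) _; rewrite geq_max bM //=.
by rewrite addnC bM.
Qed.

Let shifted (w : 'I_s -> K) (m : 'X_{1..s}) : {mpoly K[s]} :=
  \prod_i ('X_i + (w i)%:MP) ^+ m i.

Let shifted_lead w m : lead_part (mdeg m) 'X_[m] (shifted w m).
Proof.
rewrite mdegE mpolyXE_id /shifted.
have XD i : lead_part 1 'X_i ('X_i + (w i)%:MP).
  by split; rewrite ?msizeX ?mdeg1 // addrC addKr msizeC leq_b1.
have LXn d g q k : lead_part d g q -> lead_part (d * k) (g ^+ k) (q ^+ k).
  move=> L; elim: k => [|k IH].
    by rewrite muln0 !expr0 /lead_part subrr msize1 msize0.
  by rewrite mulnS !exprS; apply: lead_partM.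
elim/big_rec3: _ => [|i d g q _ L].
  by rewrite /lead_part subrr msize1 msize0.
by apply: lead_partM => //; rewrite -[X in lead_part X]mul1n; apply: LXn; apply: XD.
Qed.

Let shiftedE w m v : (shifted w m).@[v] = ev m (fun i => v i + w i).
Proof.
rewrite /shifted rmorph_prod; apply: eq_bigr => i _.
by rewrite rmorphXn rmorphD /= mevalXU mevalC.
Qed.

Let mdiff (a b : 'X_{1..s}) v := ev a v - ev b v.

(** If two monomials of degree at most [N] agree on [C], their difference [f] is
    additive on the whole affine space: for [y] in [C] the polynomial
    [f (X + y) - f X] has degree less than [N] and vanishes on [C], so it is zero;
    the same argument in [y] applies to [f (v + Y) - f v - f Y]. *)
Let relation_additive N (a b : 'X_{1..s}) :
  (forall f : {mpoly K[s]}, (msize f <= N)%N ->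
    (forall x, C x -> f.@[pt x] = 0) -> f = 0) ->
  a != b -> (mdeg a <= N)%N -> (mdeg b <= N)%N -> same a b ->
  forall v w, mdiff a b (fun i => v i + w i) = mdiff a b v + mdiff a b w.
Proof.
move=> van nab aN bN ab.
have N0 : (0 < N)%N.
  case: N aN bN {van} => //; rewrite !leqn0 !mdeg_eq0 => /eqP a0 /eqP b0.
  by rewrite a0 b0 eqxx in nab.
pose g w := (shifted w a - 'X_[a]) - (shifted w b - 'X_[b]).
have gN w : (msize (g w) <= N)%N.
  apply: leq_trans (msizeD_le _ _) _; rewrite msizeN geq_max.
  by rewrite (leq_trans (shifted_lead w a).2) // (leq_trans (shifted_lead w b).2).
have gE v w : (g w).@[v] = mdiff a b (fun i => v i + w i) - mdiff a b v.
  rewrite /g !mevalB !evX !shiftedE /mdiff !opprB.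
  by rewrite [ev b v - _]addrC addrACA; congr (_ + _); rewrite addrC.
have diff0 x : C x -> mdiff a b (pt x) = 0.
  by move=> Cx; rewrite /mdiff ab // subrr.
have ptD x y : C x -> C y -> (fun i => pt x i + pt y i) = pt (x + y).
  by move=> Cx Cy; apply/funext => i; rewrite /pt chiD.
have step1 v y : C y -> mdiff a b (fun i => v i + pt y i) = mdiff a b v.
  move=> Cy; apply/eqP; rewrite -subr_eq0 -gE (van (g (pt y))) ?meval0 //.
  by move=> x Cx; rewrite gE ptD // !diff0 ?subr0 //; apply: CD.
move=> v w; pose h := g v - (mdiff a b v)%:MP.
have hE u : h.@[u] = mdiff a b (fun i => u i + v i) - mdiff a b u - mdiff a b v.
  by rewrite mevalB mevalC gE.
have h0 : h = 0.
  apply: van => [|x Cx].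
    apply: leq_trans (msizeD_le _ _) _; rewrite msizeN geq_max gN msizeC.
    by apply: leq_trans N0; apply: leq_b1.
  rewrite hE diff0 // subr0; apply/eqP; rewrite subr_eq0; apply/eqP.
  rewrite -(step1 v x Cx); congr mdiff; apply/funext => i; exact: addrC.
have := hE w; rewrite h0 meval0 => /esym/eqP; rewrite -addrA -opprD subr_eq0.
move/eqP => E; rewrite [RHS]addrC -E; congr mdiff; apply/funext => i; exact: addrC.
Qed.

Let axis (i : 'I_s) (t : K) : 'I_s -> K := fun j => if j == i then t else 0.

Let ev_single i k v : ev (U_(i) *+ k)%MM v = v i ^+ k.
Proof.
rewrite /ev (bigD1 i) //= big1 => [|j ji].
  by rewrite mulmnE mnm1E eqxx mul1n mulr1.
by rewrite mulmnE mnm1E eq_sym (negPf ji) mul0n.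
Qed.

Let ev_axis0 (m : 'X_{1..s}) i t : m != (U_(i) *+ m i)%MM -> ev m (axis i t) = 0.
Proof.
move=> nm; have [j ji mj] : exists2 j, j != i & m j != 0%N.
  apply: contrapT => H; case/eqP: nm; apply/mnmP => j; rewrite mulmnE mnm1E.
  case: eqP => [->|/eqP ij]; first by rewrite mul1n.
  rewrite mul0n; apply/eqP; apply/negP => /negP mj; apply: H; exists j => //.
  by rewrite eq_sym.
by rewrite /ev (bigD1 j) //= /axis (negPf ji) expr0n (negPf mj) mul0r.
Qed.

Let ev_zero (m : 'X_{1..s}) : m != 0%MM -> ev m (fun=> 0) = 0.
Proof.
move=> m0; have [j mj] : exists j, m j != 0%N.
  apply: contrapT => H; case/eqP: m0; apply/mnmP => j; rewrite mnm0E.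
  by apply/eqP; apply/negP => /negP mj; apply: H; exists j.
by rewrite /ev (bigD1 j) //= expr0n (negPf mj) mul0r.
Qed.

Let ev_one (m : 'X_{1..s}) : ev m (fun=> 1) = 1.
Proof. by rewrite /ev big1 // => i _; rewrite expr1n. Qed.

Let additive_diff (a b : 'X_{1..s}) :=
  forall v w, mdiff a b (fun i => v i + w i) = mdiff a b v + mdiff a b w.

Let additive_diff0 a b : additive_diff a b -> mdiff a b (fun=> 0) = 0.
Proof.
move=> addf; have := addf (fun=> 0) (fun=> 0); rewrite addr0 => /esym/eqP.
by rewrite -subr_eq0 addrK => /eqP.
Qed.

(** An additive function is the sum of its restrictions to the axes, where every
    monomial in at least two variables vanishes. *)
Let additive_diff_sum a b v :
  additive_diff a b -> mdiff a b v = \sum_i mdiff a b (axis i (v i)).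
Proof.
move=> addf; have b0 := additive_diff0 addf.
transitivity (mdiff a b (fun j => \sum_i axis i (v i) j)).
  congr mdiff; apply/funext => j; rewrite (bigD1 j) //= /axis eqxx big1 ?addr0 //.
  by move=> i /negPf ij; rewrite eq_sym ij.
elim: (index_enum _) => [|i r IHr].
  rewrite big_nil -[RHS]b0; congr mdiff; apply/funext => j; exact: big_nil.
rewrite big_cons -IHr -addf; congr mdiff; apply/funext => j; exact: big_cons.
Qed.

Let single (m : 'X_{1..s}) := exists i, m = (U_(i) *+ m i)%MM.

Let singleN m i t : ~ single m -> ev m (axis i t) = 0.
Proof. by move=> H; apply/ev_axis0/eqP => E; apply: H; exists i. Qed.

Let additive_diffC a b : additive_diff a b -> additive_diff b a.
Proof.
move=> addf v w; have NB u : mdiff b a u = - mdiff a b u by rewrite /mdiff opprB.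
by rewrite !NB addf opprD.
Qed.

(** Compare the values at the point with all coordinates 1. *)
Let additive_diff_mixed a b : additive_diff a b -> a != 0%MM ->
  single a -> single b.
Proof.
move=> addf a0 [i ai]; apply: contrapT => nb.
have := additive_diff_sum (fun=> 1) addf.
rewrite {1}/mdiff !ev_one subrr (bigD1 i) //= big1 => [|j ji].
  rewrite /mdiff (singleN _ _ nb) subr0 addr0 [in ev a]ai ev_single /axis eqxx expr1n.
  by move/esym/eqP; rewrite oner_eq0.
rewrite /mdiff (singleN _ _ nb) subr0 ev_axis0 //.
apply: contra a0 => /eqP aj; rewrite aj; apply/eqP/mnmP => l.
by rewrite ai !mulmnE !mnm1E mnm0E [i == j]eq_sym (negPf ji) mul0n muln0.
Qed.

Let additive_diff_single a b : additive_diff a b -> a != 0%MM -> a != b ->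
  single a.
Proof.
move=> addf a0 nab; apply: contrapT => na.
case: (pselect (single b)) => [sb|nb].
  have [b0|b0] := eqVneq b 0%MM.
    have := additive_diff0 (additive_diffC addf).
    rewrite /mdiff (ev_zero a0) subr0 b0 /ev big1 => [/eqP|i _].
      by rewrite oner_eq0.
    by rewrite mnm0E.
  by apply: na; apply: additive_diff_mixed sb => //; apply: additive_diffC.
case/eqP: nab; apply/mnmP => i; apply: (@exprn_fun_inj K) => t.
have E m : ev m (fun j => if j == i then t else 1) = t ^+ m i.
  rewrite /ev (bigD1 i) //= eqxx big1 ?mulr1 // => j /negPf ->.
  by rewrite expr1n.
rewrite -!E; apply/eqP; rewrite -subr_eq0; apply/eqP.
rewrite -/(mdiff a b _) (additive_diff_sum _ addf) big1 // => j _.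
by rewrite /mdiff !singleN // subrr.
Qed.

(** Take a relation of minimal degree.  Being additive, it has the form
    [chi i ^+ k = chi j ^+ l] with [t ^+ k] and [t ^+ l] additive in [t], so that
    each exponent is 1 or divisible by [p].  Exponent 1 is excluded by the
    hypothesis on powers, and a common factor [p] can be cancelled because the
    Frobenius morphism is injective, against minimality. *)
Lemma monomials_distinct (a b : 'X_{1..s}) : same a b -> a = b.
Proof.
have [N] := ubnP (maxn (mdeg a) (mdeg b)).
elim: N a b => // N IH a b; rewrite ltnS geq_max => /andP [aN bN] ab.
apply/eqP/negP => /negP nab.
have {}van := distinct_monomials_independent (N := N).
have {}van : forall f : {mpoly K[s]}, (msize f <= N)%N ->
    (forall x, C x -> f.@[pt x] = 0) -> f = 0.
  by apply: van => m m' mN m'N; apply: IH; rewrite gtn_max mN.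
have addf := relation_additive van nab aN bN ab.
have nonzero c d : additive_diff c d -> c != d -> c != 0%MM.
  move=> addcd ncd; apply/eqP => c0; rewrite c0 in ncd addcd.
  have := additive_diff0 addcd; rewrite /mdiff (@ev_zero d) 1?eq_sym //.
  rewrite subr0 /ev big1 => [/eqP|i _]; first by rewrite oner_eq0.
  by rewrite mnm0E.
have a0 := nonzero _ _ addf nab.
have b0 : b != 0%MM by apply: nonzero (additive_diffC addf) _; rewrite eq_sym.
have [i] := additive_diff_single addf a0 nab; set k := a i => aE.
have [j] := additive_diff_mixed addf a0 (ex_intro _ i aE); set l := b j => bE.
have chik x : C x -> chi i x ^+ k = chi j x ^+ l.
  by move=> /ab; rewrite aE bE !ev_single.
have [ij|ij] := eqVneq i j.
  case/eqP: nab; rewrite aE bE -ij; congr (_ *+ _)%MM.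
  by apply: (@chi_inf i) => x /chik; rewrite -ij.
have single_expn c d i' j' k' l' : additive_diff c d -> c = (U_(i') *+ k')%MM ->
   d = (U_(j') *+ l')%MM -> d != 0%MM -> i' != j' -> k' = 1%N \/ k'%:R = 0 :> K.
  move=> addcd cE dE d0 ij'; apply: additive_expn => t u.
  have E r : mdiff c d (axis i' r) = r ^+ k'.
    rewrite /mdiff [X in _ - X]ev_axis0 ?subr0 ?cE ?ev_single /axis ?eqxx //.
    apply: contra d0 => /eqP di; rewrite di; apply/eqP/mnmP => h.
    by rewrite dE !mulmnE !mnm1E mnm0E [j' == i']eq_sym (negPf ij') mul0n muln0.
  rewrite -!E -addcd; congr mdiff; apply/funext => h; rewrite /axis.
  by case: eqP; rewrite ?addr0.
case: (single_expn _ _ _ _ _ _ addf aE bE b0 ij) => [k1|pk].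
  by case/eqP: ij; apply: (@chi_rel i j l) => x /chik; rewrite k1 expr1.
have ji : j != i by rewrite eq_sym.
case: (single_expn _ _ _ _ _ _ (additive_diffC addf) bE aE a0 ji) => [l1|pl].
  by case/eqP: ij; apply/esym/(@chi_rel j i k) => x /chik ->; rewrite l1 expr1.
have /dvdnP [k' kE] : (p %| k)%N by rewrite (dvdn_pcharf charp) pk.
have /dvdnP [l' lE] : (p %| l)%N by rewrite (dvdn_pcharf charp) pl.
have p1 := prime_gt1 (pcharf_prime charp).
have mdegU (h : 'I_s) q : mdeg (U_(h) *+ q)%MM = q by rewrite mdegMn mdeg1 mul1n.
have k0 : (0 < k)%N by rewrite -(mdegU i k) lt0n -aE mdeg_eq0.
have l0 : (0 < l)%N by rewrite -(mdegU j l) lt0n -bE mdeg_eq0.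
rewrite aE mdegU in aN; rewrite bE mdegU in bN.
have : (U_(i) *+ k' = U_(j) *+ l')%MM.
  apply: IH.
    rewrite !mdegU gtn_max; apply/andP; split.
      by apply: leq_trans aN; rewrite kE ltn_Pmulr //; case: k' kE k0 => // ->.
    by apply: leq_trans bN; rewrite lE ltn_Pmulr //; case: l' lE l0 => // ->.
  move=> x Cx; rewrite !ev_single; apply: (@fmorph_inj _ _ (pFrobenius_aut charp)).
  by rewrite /= !pFrobenius_autE -!exprM -kE -lE; apply: chik.
move/(congr1 (fun m : 'X_{1..s} => m i)); rewrite !mulmnE !mnm1E eqxx mul1n.
by rewrite (negPf ji) mul0n => k'0; rewrite kE k'0 in k0.
Qed.

Lemma characters_algebraically_independent (f : {mpoly K[s]}) :
  (forall x, C x -> f.@[fun i => chi i x] = 0) -> f = 0.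
Proof.
move=> f0; apply: (@distinct_monomials_independent (msize f)) => //.
by move=> m m' _ _; apply: monomials_distinct.
Qed.

End AlgebraicIndependence.

(** * Idempotents of closed semiprime rings *)

Section ClosedSubrings.
Variables (K : fieldType) (n : nat).
Local Notation M := 'M[K]_n.+1.

Definition subrng (A : set M) : Prop :=
  [/\ A 0, forall x y, A x -> A y -> A (x - y) &
      forall x y, A x -> A y -> A (x * y)].

(** For a ring this is equivalent to having no nonzero nilpotent ideal. *)
Definition semiprime_rng (A : set M) : Prop :=
  forall a, A a -> (forall x, A x -> a * x * a = 0) -> a = 0.

(** The last condition says that [e] is minimal among the nonzero idempotents of
    the corner [e * A * e]. *)
Definition primitive_idempotent (A : set M) (e : M) : Prop :=
  [/\ A e, e != 0, e * e = e &
      forall f, A f -> f * f = f -> f != 0 -> e * f = f -> f * e = f -> f = e].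

(** The Fitting decomposition attached to a Bezout identity: [U * X] projects on
    the part where [X] is invertible, and [V * Q] on the part killed by [X]. *)
Lemma bezout_idempotent (R : unitRingType) (V Q U X : R) :
  V * X = X * V -> Q * X = X * Q -> U * X = X * U ->
  Q * X = 0 -> V * Q + U * X = 1 ->
  [/\ U * X * (U * X) = U * X, X * (U * X) = X &
      X + (1 - U * X) \is a GRing.unit].
Proof.
move=> cV cQ cU annih uvx.
have VQ : 1 - U * X = V * Q by rewrite -uvx addrK.
have Xe : X * (U * X) = X.
  apply/eqP; rewrite eq_sym -subr_eq0 -{1}[X]mulr1 -mulrBr VQ.
  have -> : X * (V * Q) = V * (Q * X).
    by rewrite mulrA -cV -mulrA -cQ.
  by rewrite annih mulr0.
have ee : U * X * (U * X) = U * X by rewrite -mulrA Xe.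
have cXe : GRing.comm X (U * X).
  by rewrite /GRing.comm [X * (_ * _)]mulrA -cU.
have eX : U * X * X = X by rewrite -[RHS]Xe -cXe.
have UX : U * X = X * U by rewrite cU.
split=> //.
apply/unitrP; exists (U * (U * X) + (1 - U * X)).
have Ue : U * (U * X) = U * X * U by rewrite -mulrA -UX.
have fe : (1 - U * X) * (U * X) = 0 by rewrite mulrBl mul1r ee subrr.
have ef : (U * X) * (1 - U * X) = 0 by rewrite mulrBr mulr1 ee subrr.
have ff : (1 - U * X) * (1 - U * X) = 1 - U * X by rewrite mulrBr mulr1 fe subr0.
have Xf : X * (1 - U * X) = 0 by rewrite mulrBr mulr1 Xe subrr.
have fX : (1 - U * X) * X = 0 by rewrite mulrBl mul1r eX subrr.
have fU : (1 - U * X) * U = U * (1 - U * X) by rewrite mulrBl mulrBr mul1r mulr1 Ue.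
have : U * X + (1 - U * X) = 1 by rewrite addrC subrK.
move: (1 - U * X) fe ef ff Xf fX fU => f fe ef ff Xf fX fU UXf.
split.
  rewrite mulrDl !mulrDr ff fX add0r -[U * (U * X) * X]mulrA eX.
  by rewrite -[U * (U * X) * f]mulrA ef mulr0 addr0.
by rewrite mulrDl !mulrDr ff Xf addr0 mulrA -UX ee mulrA fU -mulrA fe mulr0 add0r.
Qed.

Lemma fitting_idempotent (x : M) : exists k e,
  [/\ e * e = e, x ^+ k.+1 * e = x ^+ k.+1, GRing.comm e x &
      x ^+ k.+1 + (1 - e) \is a GRing.unit].
Proof.
have [k [q + pE]] := multiplicity_XsubC (char_poly x) 0.
rewrite (monic_neq0 (char_poly_monic x)) /= subr0 in pE * => q0.
have : coprimep q ('X ^+ k.+1).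
  rewrite coprimep_sym; apply: coprimep_expl; rewrite coprimep_sym.
  by have := coprimep_XsubC q 0; rewrite polyC0 subr0 => ->.
case/Bezout_eq1_coprimepP => -[v u] /= uv.
have annih : horner_mx x q * x ^+ k.+1 = 0.
  have := Cayley_Hamilton x; rewrite pE rmorphM rmorphXn /= horner_mx_X => E.
  by rewrite exprSr mulrA E mul0r.
have comx (h : {poly K}) : GRing.comm (horner_mx x h) x.
  by have := congr1 (horner_mx x) (mulrC h 'X); rewrite !rmorphM /= horner_mx_X.
have comxn h : GRing.comm (horner_mx x h) (x ^+ k.+1) by apply/commrX/comx.
have uvx : horner_mx x v * horner_mx x q + horner_mx x u * x ^+ k.+1 = 1.
  by rewrite -[x in x ^+ _]horner_mx_X -rmorphXn -!rmorphM -rmorphD uv rmorph1.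
have [ee Xe eu] := bezout_idempotent (comxn v) (comxn q) (comxn u) annih uvx.
exists k, (horner_mx x u * x ^+ k.+1); split=> //.
by apply/commr_sym/commrM; [apply/commr_sym/comx | apply/commrX].
Qed.

Lemma subrngD (A : set M) x y : subrng A -> A x -> A y -> A (x + y).
Proof.
move=> [A0 AB _] Ax Ay; rewrite -[y]opprK -[- y]sub0r.
by apply: (AB) => //; apply: AB.
Qed.

(** The set [S] of the elements [y] of [A] with [e * y = y] is closed, and left
    multiplication by [x ^+ k.+1] maps it into itself and agrees there with the
    invertible matrix [g].  So [S] is stable under [g^-1], which sends [x ^+ k.+1]
    to [e] and [e] to the required inverse. *)
Lemma closed_idempotent (A : set M) x : subrng A -> zclosed A -> A x ->
  exists k e y, [/\ A e, A y, e * e = e, x ^+ k.+1 * e = x ^+ k.+1 &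
    [/\ x ^+ k.+1 * y = e, y * x ^+ k.+1 = e, e * y = y & y * e = y]].
Proof.
move=> [A0 AB AM] clA Ax.
have [k [e [ee xe cex ug]]] := fitting_idempotent x.
have cexk : GRing.comm e (x ^+ k.+1) by apply/commrX.
have Axk : A (x ^+ k.+1).
  by elim: (k) => [|j IH]; rewrite ?expr1 // exprS; apply: AM.
pose S := (A `&` [set y | mulmx (1 - e) y = 0])%classic.
have clS : zclosed S by apply: zclosedI => //; apply: zclosed_kernel.
have Se y : A y -> e * y = y -> S y.
  by move=> Ay ey; split=> //=; rewrite -[_ *m _]/(_ * _) mulrBl mul1r ey subrr.
have eS y : S y -> e * y = y.
  case=> _ /=; rewrite -[_ *m _]/(_ * _) mulrBl mul1r => /eqP.
  by rewrite subr_eq0 => /eqP.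
have AS y : S y -> A y by case.
pose g := x ^+ k.+1 + (1 - e).
have gE y : S y -> g * y = x ^+ k.+1 * y.
  by move=> Sy; rewrite mulrDl mulrBl mul1r eS // subrr addr0.
have ge : g * e = x ^+ k.+1 by rewrite mulrDl mulrBl mul1r ee subrr addr0.
have Sinv y : S y -> S (g^-1 * y).
  apply: zclosed_stable_inv => // z Sz; rewrite -[_ *m _]/(_ * _) gE //.
  by apply: Se; [apply/AM/AS|rewrite mulrA cexk -mulrA eS].
have Sxk : S (x ^+ k.+1) by apply: Se => //; rewrite cexk.
have Seps : S e by have := Sinv _ Sxk; rewrite -ge mulKr.
have Sy := Sinv _ Seps; set y := g^-1 * e in Sy.
have gy : g * y = e by rewrite mulrA divrr ?mul1r.
exists k, e, y; split=> //; [exact: AS|exact: AS|split].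
- by rewrite -gE.
- by rewrite /y -mulrA cexk xe -ge mulKr.
- exact: eS.
- by rewrite /y -mulrA ee.
Qed.

(** Suppose that [A * y] is nil with [y] nonzero of minimal rank.  For [x] in [A],
    let [w] be the last nonzero power of [x * y], unless [x * y = 0].  It lies in
    [A * y], so by minimality it has the row space of [y]; as [w * (x * y) = 0],
    also [y * x * y = 0].  Thus [y * A * y = 0], contradicting semiprimeness. *)
Lemma nonnil_multiple (A : set M) a : subrng A -> semiprime_rng A ->
  A a -> a != 0 -> exists2 b, A b & forall k, (b * a) ^+ k != 0.
Proof.
move=> [A0 AB AM] sA Aa a0; apply: contrapT => nil_a.
have {nil_a} : forall b, A b -> exists k, (b * a) ^+ k == 0.
  move=> b Ab; apply: contrapT => nk; apply: nil_a; exists b => // k.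
  by apply/negP => k0; apply: nk; exists k.
have [r] := ubnP (\rank a); elim: r a Aa a0 => // r IH y Ay y0; rewrite ltnS.
move=> ry nil_y; case/eqP: y0; apply: sA => // x Ax.
apply/eqP/negP => /negP yxy.
case: (ex_minnP (nil_y x Ax)) => [[|[|k]]] /eqP xyk mink.
- by move/eqP: xyk; rewrite oner_eq0.
- by move: yxy; rewrite -mulrA -[x * y]expr1 xyk mulr0 eqxx.
pose w := (x * y) ^+ k.+1.
have wE : exists2 w', A w' & w = w' * y.
  exists ((x * y) ^+ k * x); last by rewrite -mulrA -exprSr.
  elim: (k) => [|j IHj]; first by rewrite mul1r.
  by rewrite exprS -mulrA; apply: (AM) => //; apply: AM.
case: wE => w' Aw' wE.
have w0 : w != 0 by apply/negP => /mink; rewrite ltnn.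
have Aw : A w by rewrite wE; apply: AM.
have wy : (w <= y)%MS by rewrite wE submxMl.
have [lt_wy|le_yw] := ltnP (\rank w) (\rank y).
  apply: (IH w) => //; first exact: leq_trans lt_wy ry.
  by move=> b Ab; rewrite wE mulrA; apply: nil_y; apply: AM.
have /submxP [W yW] : (y <= w)%MS by rewrite (geq_leqif (mxrank_leqif_sup wy)) in le_yw.
move: yxy; rewrite {1}yW -[_ *m _]/(_ * _) -!mulrA -exprSr xyk.
by rewrite mulr0 eqxx.
Qed.

Lemma left_ideal_idempotent (A : set M) a :
  subrng A -> zclosed A -> semiprime_rng A -> A a -> a != 0 ->
  exists e z, [/\ A e, A z, e != 0, e * e = e & e = z * a].
Proof.
move=> sr clA sA Aa a0; have [b Ab ba] := nonnil_multiple sr sA Aa a0.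
have [A0 AB AM] := sr; have Aba : A (b * a) by apply: AM.
have [k [e [y [Ae Ay ee xe [xy yx ey ye]]]]] := closed_idempotent sr clA Aba.
exists e, (y * (b * a) ^+ k * b); split=> //.
- have Abak : A ((b * a) ^+ k * b).
    elim: (k) => [|j IH]; first by rewrite mul1r.
    by rewrite exprS -mulrA; apply: (AM).
  by rewrite -mulrA; apply: (AM).
- by apply: contraNneq (ba k.+1) => e0; rewrite -xe e0 mulr0.
- by rewrite -yx -!mulrA -exprSr.
Qed.

(** The left ideal [A * u] contains an idempotent [f = z * u]; then [e * f] is a
    nonzero idempotent of the corner of [e], hence equal to [e].  This gives a left
    inverse [v] of [u], and [u * v] is a nonzero idempotent in the corner of [e']. *)
Lemma primitive_invertible (A : set M) e e' u :
  subrng A -> zclosed A -> semiprime_rng A ->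
  primitive_idempotent A e -> primitive_idempotent A e' ->
  A u -> u != 0 -> e' * u = u -> u * e = u ->
  exists v, [/\ A v, e * v = v, v * e' = v, v * u = e & u * v = e'].
Proof.
move=> sr clA sA [Ae e0 ee emin] [Ae' e'0 e'e' e'min] Au u0 e'u ue.
have [A0 AB AM] := sr.
have [f [z [Af Az f0 ff fE]]] := left_ideal_idempotent sr clA sA Au u0.
have fe : f * e = f by rewrite fE -mulrA ue.
have efe : e * f = e.
  apply: emin; [exact: AM| | |by rewrite mulrA ee|by rewrite -mulrA fe].
    by rewrite mulrA -[e * f * e]mulrA fe -mulrA ff.
  by apply: contraNneq f0 => ef0; rewrite -ff -{1}fe -mulrA ef0 mulr0.
pose v := e * z * e'.
have vu : v * u = e by rewrite /v -!mulrA e'u -fE.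
have Av : A v by rewrite /v; apply: (AM) => //; apply: AM.
have uv0 : u * v != 0.
  apply: contraNneq e0 => uv0; rewrite -ee -{1}vu -[e in _ * e]vu.
  by rewrite mulrA -[v * u * v]mulrA uv0 mulr0 mul0r.
have ev : e * v = v by rewrite /v !mulrA ee.
exists v; split=> //; first by rewrite /v -!mulrA e'e'.
apply: e'min => //; first exact: AM.
- by rewrite mulrA -[u * v * u]mulrA vu -mulrA ev.
- by rewrite mulrA e'u.
- by rewrite -mulrA /v -!mulrA e'e'.
Qed.

Lemma idempotent_rank_lt (e f : M) :
  e * e = e -> e * f = e -> f * e = e -> e != f -> (\rank e < \rank f)%N.
Proof.
move=> ee ef fe nef; rewrite ltnNge; apply: contra nef => le_fe.
have ef_le : (e <= f)%MS by rewrite -ef submxMl.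
have /submxP [X fX] : (f <= e)%MS by rewrite (geq_leqif (mxrank_leqif_sup ef_le)) in le_fe.
by rewrite -fe [in X in _ == X]fX {1}fX -[X *m e]/(X * e) -mulrA ee.
Qed.

Lemma primitive_below (A : set M) h : A h -> h != 0 -> h * h = h ->
  exists e, [/\ primitive_idempotent A e, h * e = e & e * h = e].
Proof.
have [r] := ubnP (\rank h); elim: r h => // r IH h; rewrite ltnS => hr Ah h0 hh.
have [hprim|hprim] := pselect (primitive_idempotent A h); first by exists h.
have [f [Af ff f0 [hf fh] fneh]] : exists f,
    [/\ A f, f * f = f, f != 0, h * f = f /\ f * h = f & f != h].
  apply: contrapT => nf; apply: hprim; split=> // f Af ff f0 hf fh.
  by apply/eqP/negP => /negP fneh; apply: nf; exists f.
have lt_fh := idempotent_rank_lt ff fh hf fneh.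
have [e [eprim fe ef]] := IH f (leq_trans lt_fh hr) Af f0 ff.
by exists e; split=> //; [rewrite -fe mulrA hf|rewrite -ef -mulrA fh].
Qed.

(** An idempotent [h] in the left ideal generated by [x - x * f] satisfies
    [h * f = 0]; replacing it by [h - f * h] makes it orthogonal to [f] on both
    sides. *)
Lemma primitive_orthogonal_to (A : set M) f x :
  subrng A -> zclosed A -> semiprime_rng A ->
  A f -> f * f = f -> A x -> x != x * f ->
  exists g, [/\ primitive_idempotent A g, f * g = 0 & g * f = 0].
Proof.
move=> sr clA sA Af ff Ax xf; have [A0 AB AM] := sr.
have Ad : A (x - x * f) by apply: AB => //; apply: AM.
have d0 : x - x * f != 0 by rewrite subr_eq0.
have [h [z [Ah Az h0 hh hE]]] := left_ideal_idempotent sr clA sA Ad d0.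
have hf : h * f = 0 by rewrite hE mulrBr mulrBl -!mulrA ff subrr.
pose h' := h - f * h.
have h'h' : h' * h' = h'.
  by rewrite /h' mulrBr !mulrBl mulrA hf mul0r -[f * h * _]mulrA hh mulrA
    -[f * h * f]mulrA hf mulr0 mul0r !subr0 // hh.
have h'0 : h' != 0.
  rewrite subr_eq0; apply: contraNneq h0 => E.
  by rewrite -hh {2}E mulrA hf mul0r.
have Ah' : A h' by apply: (AB) => //; apply: AM.
have fh' : f * h' = 0 by rewrite /h' mulrBr mulrA ff subrr.
have h'f : h' * f = 0 by rewrite /h' mulrBl -mulrA hf mulr0 subr0.
have [g [gprim h'g gh']] := primitive_below Ah' h'0 h'h'.
exists g; split=> //; first by rewrite -h'g mulrA fh' mul0r.
by rewrite -gh' -mulrA h'f mulr0.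
Qed.

(** As long as the sum of an orthogonal family of primitive idempotents is not a
    right unit of [A], the family can be extended, which increases the rank of its
    sum.  Once it is a right unit, [x - f * x] is annihilated on the left by [A],
    so it is 0 by semiprimeness. *)
Lemma complete_orthogonal_primitives (A : set M) :
  subrng A -> zclosed A -> semiprime_rng A ->
  exists r (e : 'I_r -> M), [/\ forall i, primitive_idempotent A (e i),
    forall i j, i != j -> e i * e j = 0 &
    forall x, A x -> (\sum_i e i) * x = x /\ x * (\sum_i e i) = x].
Proof.
move=> sr clA sA; have [A0 AB AM] := sr.
pose family (s : seq M) := (forall x, x \in s -> primitive_idempotent A x) /\
  pairwise (fun x y => (x * y == 0) && (y * x == 0)) s.
have idem s : family s -> [/\ A (\sum_(x <- s) x),
    (\sum_(x <- s) x) * (\sum_(x <- s) x) = \sum_(x <- s) x &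
    forall x, x \in s ->
     (\sum_(x <- s) x) * x = x /\ x * (\sum_(x <- s) x) = x].
  elim: s => [|g s IH] [prims orth]; first by rewrite !big_nil mulr0; split.
  have [|As ss sx] := IH.
    split=> [x xs|]; first by apply: prims; rewrite in_cons xs orbT.
    by move: orth; rewrite /= => /andP [].
  have [Ag _ gg _] := prims g (mem_head g s).
  have gs x : x \in s -> g * x = 0 /\ x * g = 0.
    by move: orth => /= /andP [/allP H _] /H /andP [/eqP -> /eqP ->].
  have gS : g * \sum_(x <- s) x = 0.
    by rewrite mulr_sumr big_seq big1 // => x /gs [].
  have Sg : (\sum_(x <- s) x) * g = 0.
    by rewrite mulr_suml big_seq big1 // => x /gs [].
  rewrite !big_cons; split.
  - exact: subrngD.
  - by rewrite mulrDl !mulrDr gg ss gS Sg addr0 add0r.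
  move=> x; rewrite in_cons => /predU1P [->|xs].
    by rewrite mulrDl mulrDr gg gS Sg addr0.
  have [gx xg] := gs x xs; have [Sx xS] := sx x xs.
  by rewrite mulrDl mulrDr gx xg Sx xS !add0r.
have [s [fam_s full]] : exists s, family s /\
    forall x, A x -> x * (\sum_(y <- s) y) = x.
  apply: contrapT => nofull.
  have grow r : exists s, family s /\ (r <= \rank (\sum_(x <- s) x : M)%R)%N.
    elim: r => [|r [s [fam_s rs]]].
      by exists [::]; split=> //; split.
    have [x Ax xs] : exists2 x, A x & x != x * (\sum_(y <- s) y).
      apply: contrapT => H; apply: nofull; exists s; split=> // x Ax.
      by apply/eqP; rewrite eq_sym; apply: contrapT => /negP ne; apply: H; exists x.
    have [As ss sx] := idem s fam_s.
    have [g [gprim sg gs]] := primitive_orthogonal_to sr clA sA As ss Ax xs.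
    have [prims orth] := fam_s.
    exists (g :: s); split.
      split=> [y|/=]; first by rewrite in_cons => /predU1P [->|/prims].
      rewrite orth andbT; apply/allP => y /sx [Sy yS].
      by rewrite -{1}Sy mulrA gs mul0r eqxx -[in y * g]yS -mulrA sg mulr0 eqxx.
    apply: leq_ltn_trans rs _; rewrite big_cons.
    have [Ag g0 gg _] := gprim.
    apply: idempotent_rank_lt; rewrite // ?mulrDr ?mulrDl ?sg ?gs ?ss ?add0r //.
    by rewrite -subr_eq0 opprD addrCA subrr addr0 oppr_eq0.
  have [s [_]] := grow n.+2.
  by rewrite leqNgt ltnS rank_leq_row.
exists (size s), (fun i => s`_i); have [prims orth] := fam_s; split.
- by move=> i; apply/prims/mem_nth.
- move=> i j ij; have := pairwiseP 0 orth.
  move: ij; rewrite neq_ltn => /orP [] lt_ij /(_ _ _ (ltn_ord _) (ltn_ord _) lt_ij);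
  by case/andP => /eqP ? /eqP ?.
move=> x Ax; have S_E : \sum_(i < size s) s`_i = \sum_(y <- s) y.
  by rewrite (big_nth 0) big_mkord.
rewrite S_E; split; last exact: full.
have [As ss _] := idem s fam_s.
set f := \sum_(y <- s) y in As ss full *.
apply/eqP; rewrite eq_sym -subr_eq0; apply/eqP; apply: sA.
  by apply: (AB) => //; apply: AM.
by move=> y Ay; rewrite -mulrA mulrBr [y * (f * x)]mulrA full // subrr mulr0.
Qed.

End ClosedSubrings.

(** * Division subrings as types *)

(** The corners of a matrix ring are the intended examples, so the unit is an
    idempotent of [R] that is part of the data and may differ from 1. *)
Record divisionSubring (R : nzRingType) := DivisionSubring {
  ds_carrier :> R -> Prop;
  ds_unit : R;
  ds_unitP : ds_carrier ds_unit;
  ds_unit_neq0 : ds_unit != 0;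
  dsB : forall x y, ds_carrier x -> ds_carrier y -> ds_carrier (x - y);
  dsM : forall x y, ds_carrier x -> ds_carrier y -> ds_carrier (x * y);
  ds_mul1 : forall x, ds_carrier x -> ds_unit * x = x;
  ds_mulr1 : forall x, ds_carrier x -> x * ds_unit = x;
  dsV : forall x, ds_carrier x -> x != 0 ->
    exists2 y, ds_carrier y & y * x = ds_unit /\ x * y = ds_unit }.

Record fieldSubring (R : nzRingType) := FieldSubring {
  fs_division :> divisionSubring R;
  fs_mulC : forall x y, fs_division x -> fs_division y -> x * y = y * x }.

Section DivisionSubringType.
Variables (R : nzRingType) (D : divisionSubring R).

Lemma ds0 : D 0. Proof. by rewrite -(subrr (ds_unit D)); apply: dsB; apply: ds_unitP. Qed.
Lemma dsN x : D x -> D (- x).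
Proof. by move=> Dx; rewrite -sub0r; apply: dsB => //; apply: ds0. Qed.
Lemma dsD x y : D x -> D y -> D (x + y).
Proof. by move=> Dx Dy; rewrite -[y]opprK; apply: dsB => //; apply: dsN. Qed.

Definition ds_type : Type := {x : R | `[< D x >]}.
HB.instance Definition _ := SubType.on ds_type.
HB.instance Definition _ := Choice.on ds_type.

Definition ds_mk x (Dx : D x) : ds_type := exist _ x (introT (asboolP _) Dx).
Lemma ds_valP (x : ds_type) : D (val x). Proof. exact: (asboolW (valP x)). Qed.
Lemma ds_ext (x y : ds_type) : val x = val y -> x = y. Proof. exact: val_inj. Qed.

Definition ds_zero := ds_mk ds0.
Definition ds_opp (x : ds_type) := ds_mk (dsN (ds_valP x)).
Definition ds_add (x y : ds_type) := ds_mk (dsD (ds_valP x) (ds_valP y)).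
Definition ds_one := ds_mk (ds_unitP D).
Definition ds_mul (x y : ds_type) := ds_mk (dsM (ds_valP x) (ds_valP y)).

Lemma ds_addA : associative ds_add. Proof. by move=> x y z; apply: ds_ext; rewrite /= addrA. Qed.
Lemma ds_addC : commutative ds_add. Proof. by move=> x y; apply: ds_ext; rewrite /= addrC. Qed.
Lemma ds_add0 : left_id ds_zero ds_add. Proof. by move=> x; apply: ds_ext; rewrite /= add0r. Qed.
Lemma ds_addN : left_inverse ds_zero ds_opp ds_add.
Proof. by move=> x; apply: ds_ext; rewrite /= addNr. Qed.
HB.instance Definition _ := GRing.isZmodule.Build ds_type ds_addA ds_addC ds_add0 ds_addN.

Lemma ds_mulA : associative ds_mul. Proof. by move=> x y z; apply: ds_ext; rewrite /= mulrA. Qed.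
Lemma ds_one_mul : left_id ds_one ds_mul.
Proof. by move=> x; apply: ds_ext; apply: ds_mul1; apply: ds_valP. Qed.
Lemma ds_mul_one : right_id ds_one ds_mul.
Proof. by move=> x; apply: ds_ext; apply: ds_mulr1; apply: ds_valP. Qed.
Lemma ds_mulDl : left_distributive ds_mul ds_add.
Proof. by move=> x y z; apply: ds_ext; rewrite /= mulrDl. Qed.
Lemma ds_mulDr : right_distributive ds_mul ds_add.
Proof. by move=> x y z; apply: ds_ext; rewrite /= mulrDr. Qed.
Lemma ds_one_neq0 : ds_one != 0.
Proof. by apply: contra_neq (ds_unit_neq0 D) => /(congr1 val). Qed.
HB.instance Definition _ := GRing.Zmodule_isNzRing.Build ds_type
  ds_mulA ds_one_mul ds_mul_one ds_mulDl ds_mulDr ds_one_neq0.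

Lemma ds_inv_exists (x : ds_type) : exists y : ds_type,
  (x != 0 -> y * x = 1 /\ x * y = 1) /\ (x = 0 -> y = x).
Proof.
have [->|x0] := eqVneq x 0; first by exists 0.
have [|y Dy [yx xy]] := dsV (ds_valP x); first by apply: contra_neq x0 => vx; apply: ds_ext.
by exists (ds_mk Dy); split=> [_|E]; [split; apply: ds_ext|rewrite E eqxx in x0].
Qed.

Definition ds_inv (x : ds_type) : ds_type := projT1 (cid (ds_inv_exists x)).

Lemma ds_invP (x : ds_type) : x != 0 -> ds_inv x * x = 1 /\ x * ds_inv x = 1.
Proof. by move=> x0; rewrite /ds_inv; case: cid => y /= [/(_ x0)]. Qed.

Fact ds_mulV : {in [pred x | x != 0], left_inverse 1 ds_inv *%R}.
Proof. by move=> x /ds_invP []. Qed.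
Fact ds_divr : {in [pred x | x != 0], right_inverse 1 ds_inv *%R}.
Proof. by move=> x /ds_invP []. Qed.
Fact ds_unitrP (x y : ds_type) : y * x = 1 /\ x * y = 1 -> x != 0.
Proof.
case=> yx _; apply/eqP => x0; move: yx; rewrite x0 mulr0 => /esym/eqP.
by rewrite oner_eq0.
Qed.
Fact ds_inv_out : {in [predC [pred x | x != 0]], ds_inv =1 id}.
Proof. by move=> x; rewrite !inE negbK /ds_inv => /eqP x0; case: cid => y /= [_ /(_ x0)]. Qed.
HB.instance Definition _ := GRing.NzRing_hasMulInverse.Build ds_type
  ds_mulV ds_divr ds_unitrP ds_inv_out.

End DivisionSubringType.

(** Wedderburn's little theorem, transported to a subring through an enumeration. *)
Lemma finite_division_subring_comm (R : nzRingType) (D : divisionSubring R) (s : seq R) :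
  (forall x, D x -> x \in s) -> forall x y, D x -> D y -> x * y = y * x.
Proof.
move=> Ds; pose T := ds_type D.
pose f (x : T) : 'I_(size s).+1 := inord (index (val x) s).
pose g (i : 'I_(size s).+1) : option T := insub (nth 0 s i).
have fK : pcancel f g.
  move=> x; rewrite /g inordK; last by rewrite ltnS index_size.
  by rewrite nth_index ?valK // Ds //; apply: ds_valP.
pose cT : countType := HB.pack T (PCanIsCountable fK).
pose fC : isFinite cT := @PCanIsFinite cT 'I_(size s).+1 f g fK.
pose fT : finUnitRingType := HB.pack T (PCanIsCountable fK) fC.
have dom : GRing.integral_domain_axiom fT.
  move=> x y; rewrite -[x * y]/((x : T) * (y : T)) => xy.
  apply/orP; have [x0|x0] := eqVneq (x : T) 0; [by left; apply/eqP|right; apply/eqP].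
  by rewrite -[LHS](mul1r (y : T)) -(ds_invP x0).1 -mulrA xy mulr0.
move=> x y Dx Dy.
exact: (congr1 val (finDomain_mulrC dom (ds_mk Dx) (ds_mk Dy))).
Qed.

Section FieldSubringType.
Variables (R : nzRingType) (D : fieldSubring R).
Definition fs_type : Type := ds_type D.
HB.instance Definition _ := GRing.UnitRing.on fs_type.
HB.instance Definition _ := SubType.on fs_type.
Fact fs_type_mulC : commutative ( *%R : fs_type -> fs_type -> fs_type).
Proof. by move=> x y; apply: ds_ext; apply: fs_mulC; apply: ds_valP. Qed.
HB.instance Definition _ := GRing.PzRing_hasCommutativeMul.Build fs_type fs_type_mulC.
Fact fs_type_field : GRing.field_axiom fs_type.
Proof. by []. Qed.
HB.instance Definition _ := GRing.ComUnitRing_isField.Build fs_type fs_type_field.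
End FieldSubringType.

(** * Frobenius powers, and closed division rings in characteristic zero *)

Section DivisionArithmetic.
Variables (R : nzRingType) (D : divisionSubring R).
Local Notation e := (ds_unit D).

Lemma ds_mul_eq0 x y : D x -> D y -> x * y = 0 -> x = 0 \/ y = 0.
Proof.
move=> Dx Dy xy; have [->|x0] := eqVneq x 0; [by left|right].
have [v Dv [vx _]] := dsV Dx x0.
by rewrite -(ds_mul1 Dy) -vx -mulrA xy mulr0.
Qed.

Lemma dsX x k : D x -> D (x ^+ k.+1).
Proof. by move=> Dx; elim: k => [|k IH]; rewrite ?expr1 // exprS; apply: dsM. Qed.

Lemma dsX_neq0 x k : D x -> x != 0 -> x ^+ k.+1 != 0.
Proof.
move=> Dx x0; elim: k => [|k IH]; first by rewrite expr1.
apply/eqP; rewrite exprS => /(ds_mul_eq0 Dx (dsX k Dx)) [] E.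
  by rewrite E eqxx in x0.
by rewrite E eqxx in IH.
Qed.

Lemma ds_unitX k : e ^+ k.+1 = e.
Proof.
elim: k => [|k IH]; first by rewrite expr1.
by rewrite exprS IH ds_mul1 //; apply: ds_unitP.
Qed.

End DivisionArithmetic.

Lemma exprB_pchar_comm (R : nzRingType) p (x y : R) N : p \in [pchar R] ->
  x * y = y * x -> (x - y) ^+ (p ^ N) = x ^+ (p ^ N) - y ^+ (p ^ N).
Proof.
move=> chp xy; elim: N => [|N IH]; first by rewrite !expr1.
rewrite !expnSr !exprM IH -!(pFrobenius_autE chp) pFrobenius_autB_comm //.
by apply/commrX/commr_sym/commrX.
Qed.

Section ClosedDivisionSubring.
Variables (K : closedFieldType) (n : nat).
Local Notation M := 'M[K]_n.+1.

Lemma pchar_matrix p : p \in [pchar K] -> p \in [pchar M].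
Proof.
case/andP => pp /eqP p0; apply/andP; split=> //.
by rewrite -(rmorph_nat (@scalar_mx K n.+1)) p0 rmorph0.
Qed.

(** With [q] a power of [p] exceeding the size, the product of the [x - z] over the
    distinct eigenvalues has a vanishing [q]-th power, which equals the product of
    the [x ^+ q - z ^+ q].  So [x ^+ q] is killed by a polynomial with simple
    roots. *)
Lemma diagonalizable_pexp p N (x : M) : p \in [pchar K] -> (n < p ^ N)%N ->
  exists2 P, P \in unitmx & is_diag_mx (P *m x ^+ (p ^ N) *m invmx P).
Proof.
move=> chp nN; set q := (p ^ N)%N.
suff [P Pu Pd] : diagonalizable (x ^+ q) by exists P; rewrite -?conjumx.
have [r rE] := closed_field_poly_normal (char_poly x).
rewrite (monicP (char_poly_monic x)) scale1r in rE.
have sr : size r = n.+1.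
  by have := size_char_poly x; rewrite rE size_prod_XsubC => - [].
apply/diagonalizableP; exists [seq z ^+ q | z <- undup r].
  rewrite map_inj_uniq ?undup_uniq // => a b ab; apply/eqP.
  have := exprB_pchar_comm N chp (mulrC a b); rewrite -/q ab subrr => /eqP.
  by rewrite expf_eq0 subr_eq0 => /andP [].
apply: mxminpoly_min; rewrite big_map rmorph_prod /=.
transitivity (horner_mx x (\prod_(z <- undup r) ('X - z%:P) ^+ q)).
  rewrite rmorph_prod /=; apply: eq_bigr => z _.
  have hX (y : M) c : horner_mx y ('X - c%:P) = y - c%:M.
    by rewrite rmorphB /= horner_mx_X horner_mx_C.
  rewrite [RHS]rmorphXn /= !hX exprB_pchar_comm ?pchar_matrix //.
    by rewrite -rmorphXn.
  by rewrite -![_ * _]/(_ *m _) scalar_mxC.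
have /dvdpP [h ->] : char_poly x %| \prod_(z <- undup r) ('X - z%:P) ^+ q.
  rewrite rE -prodr_undup_exp_count; apply: (big_ind2 (fun u v => u %| v)) => //.
    by move=> a b c d; apply: dvdp_mul.
  move=> z _; apply: dvdp_exp2l; apply: leq_trans nN; rewrite -sr; exact: count_size.
by rewrite rmorphM /= Cayley_Hamilton mulr0.
Qed.

(** For [f] vanishing on [A], the polynomial [c |-> f (c x)] vanishes at all natural
    numbers. *)
Lemma closed_pchar0_scale (A : set M) : (forall m, (m.+1)%:R != 0 :> K) ->
  zclosed A -> A 0 -> (forall x y, A x -> A y -> A (x + y)) ->
  forall c x, A x -> A (c *: x).
Proof.
move=> ch0 clA A0 AD c x Ax; apply: clA => f pf f0.
have [q qE] : exists q : {poly K}, forall c, f (c *: x) = q.[c].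
  elim: pf {f0} => [a|{}f flin|{}f g _ [q1 q1E] _ [q2 q2E]|{}f g _ [q1 q1E] _ [q2 q2E]].
  - by exists a%:P => d; rewrite hornerC.
  - exists (f x *: 'X) => d; rewrite hornerZ hornerX mulrC.
    by have := flin d x 0; rewrite addr0 => ->; have := flin (-1) 0 0;
      rewrite scaler0 addr0 mulN1r addNr => ->; rewrite addr0.
  - by exists (q1 + q2) => d; rewrite hornerD q1E q2E.
  - by exists (q1 * q2) => d; rewrite hornerM q1E q2E.
suff q0 : q = 0 by rewrite qE q0 horner0.
apply/eqP/negP => /negP q0.
pose rs := [seq k%:R : K | k <- iota 0 (size q)].
have : (size rs < size q)%N.
  apply: max_poly_roots => //.
    apply/allP => _ /mapP [k _ ->]; rewrite rootE -qE f0 //.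
    elim: k => [|k IH]; first by rewrite scale0r.
    by rewrite -natr1 scalerDl scale1r; apply: AD.
  rewrite map_inj_uniq ?iota_uniq // => a b.
  wlog ab : a b / (a <= b)%N => [W|].
    by case: (leqP a b) => [|/ltnW] ab E; [apply: W|apply/esym/W].
  rewrite -(subnK ab) addnC natrD => /eqP; rewrite -subr_eq0 opprD addNKr oppr_eq0.
  by case: (b - a)%N => [|d]; rewrite ?addn0 // (negPf (ch0 d)).
by rewrite size_map size_iota ltnn.
Qed.

(** The product of the [x - c e] over the eigenvalues [c] of [x] is 0 by
    Cayley-Hamilton, and its factors lie in the domain [D]. *)
Lemma pchar0_division_comm (D : divisionSubring M) :
  (forall m, (m.+1)%:R != 0 :> K) -> zclosed (D : M -> Prop) ->
  forall x y, D x -> D y -> x * y = y * x.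
Proof.
move=> ch0 clD x y Dx Dy; set e := ds_unit D.
have DZ c z : D z -> D (c *: z).
  by apply: closed_pchar0_scale => //; [apply: ds0|apply: dsD].
have De : D e := ds_unitP D.
suff [c xE] : exists c, x = c *: e.
  by rewrite xE -scalerAl -scalerAr ds_mul1 // ds_mulr1.
apply: contrapT => nx.
have [r rE] := closed_field_poly_normal (char_poly x).
rewrite (monicP (char_poly_monic x)) scale1r in rE.
pose Px s := e * horner_mx x (\prod_(z <- s) ('X - z%:P)).
suff /(_ r) [_] : forall s, D (Px s) /\ Px s != 0.
  by rewrite /Px -rE Cayley_Hamilton mulr0 eqxx.
elim=> [|c s [DP P0]]; first by rewrite /Px big_nil rmorph1 mulr1 ds_unit_neq0.
have Dxc : D (x - c *: e) by apply: dsB => //; apply: DZ.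
have -> : Px (c :: s) = (x - c *: e) * Px s.
  rewrite /Px big_cons rmorphM /= rmorphB /= horner_mx_X horner_mx_C !mulrA.
  congr (_ * _); rewrite mulrBr mulrBl (ds_mul1 Dx) (ds_mulr1 Dx); congr (_ - _).
  by rewrite -scalerAl (ds_mul1 De) -[LHS]/(e *m _) mul_mx_scalar.
split; first exact: dsM.
apply/eqP => /(ds_mul_eq0 Dxc DP) [/eqP|/eqP]; last by rewrite (negPf P0).
by rewrite subr_eq0 => /eqP xE; apply: nx; exists c.
Qed.

End ClosedDivisionSubring.

(** * Diagonal elements of a division subring *)

(** A polynomial function composed with a polynomial parametrization is given by a
    polynomial in the parameters. *)
Lemma polyfun_mpoly (K : fieldType) m n s (z : ('I_s -> K) -> 'M[K]_(m, n)) :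
  (forall i j, exists g : {mpoly K[s]}, forall t, z t i j = g.@[t]) ->
  forall f, polyfun f -> exists g : {mpoly K[s]}, forall t, f (z t) = g.@[t].
Proof.
move=> zE f; elim=> {f} [a|f flin|f1 f2 _ [g1 E1] _ [g2 E2]|f1 f2 _ [g1 E1] _ [g2 E2]].
- by exists a%:MP => t; rewrite mevalC.
- have /choice [g gE] : forall ij : 'I_m * 'I_n, exists g : {mpoly K[s]},
      forall t, z t ij.1 ij.2 = g.@[t] by move=> ij; apply: zE.
  exists (\sum_i \sum_j f (delta_mx i j) *: g (i, j)) => t.
  pose f' : {linear 'M[K]_(m, n) -> K^o} :=
    HB.pack f (GRing.isLinear.Build _ _ _ _ f flin).
  have fS (I : finType) (F : I -> 'M[K]_(m, n)) : f (\sum_i F i) = \sum_i f (F i).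
    exact: (raddf_sum f').
  have fZ c x : f (c *: x) = c * f x by exact: (linearZ_LR f').
  rewrite [z t]matrix_sum_delta fS raddf_sum; apply: eq_bigr => i _.
  rewrite fS raddf_sum; apply: eq_bigr => j _.
  by rewrite /= mevalZ -gE mulrC fZ.
- by exists (g1 + g2) => t; rewrite mevalD E1 E2.
- by exists (g1 * g2) => t; rewrite mevalM E1 E2.
Qed.

Section DiagonalElements.
Variables (K : closedFieldType) (n : nat).
Local Notation M := 'M[K]_n.+1.
Variable D : divisionSubring M.
Local Notation e := (ds_unit D).

Definition diagonal (c : M) := forall i j, i != j -> c i j = 0.

Lemma diagonal_mulE c (d : M) i j : diagonal c -> (c * d) i j = c i i * d i j.
Proof.
move=> dc; rewrite mxE (bigD1 i) //= big1 ?addr0 // => k ki.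
by rewrite dc 1?eq_sym // mul0r.
Qed.

Lemma mul_diagonalE c (d : M) i j : diagonal c -> (d * c) i j = d i j * c j j.
Proof.
move=> dc; rewrite mxE (bigD1 j) //= big1 ?addr0 // => k kj.
by rewrite dc // mulr0.
Qed.

Lemma diagonalM c d : diagonal c -> diagonal d -> diagonal (c * d).
Proof. by move=> dc dd i j ij; rewrite diagonal_mulE // dd // mulr0. Qed.

Lemma diagonalB c d : diagonal c -> diagonal d -> diagonal (c - d).
Proof. by move=> dc dd i j ij; rewrite !mxE dc // dd // subr0. Qed.

Lemma diagonalX c k : diagonal c -> diagonal (c ^+ k).
Proof.
move=> dc; elim: k => [|k IH]; first by move=> i j ij; rewrite mxE (negPf ij).
by rewrite exprS; apply: diagonalM.
Qed.

Lemma diagonalXE c k i : diagonal c -> (c ^+ k) i i = c i i ^+ k.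
Proof.
move=> dc; elim: k => [|k IH]; first by rewrite mxE eqxx.
by rewrite !exprS diagonal_mulE // IH.
Qed.

Lemma ds_unit_diagonal u : D u -> u != 0 -> diagonal u -> diagonal e.
Proof.
move=> Du u0 du i j ij; have [v Dv [vu uv]] := dsV Du u0.
have := mul_diagonalE v i j du; rewrite vu => E.
have [uj|uj] := eqVneq (u j j) 0; first by rewrite E uj mulr0.
have := mul_diagonalE e i j du; rewrite (ds_mul1 Du) (du _ _ ij) => /esym/eqP.
by rewrite mulf_eq0 (negPf uj) orbF => /eqP.
Qed.

Hypothesis de : diagonal e.

(** The unit of [D] is diagonal with entries 0 and 1; all elements of [D] live on
    the rows and columns where it is 1. *)
Definition ds_support := [set i | e i i != 0].
Local Notation I0 := ds_support.

Lemma ds_unit_entry i : i \in I0 -> e i i = 1.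
Proof.
rewrite inE => ei; apply: (mulfI ei).
by rewrite -diagonal_mulE // ds_mul1 ?mulr1 //; apply: ds_unitP.
Qed.

Lemma ds_entry_support d i j : D d -> d i j != 0 -> i \in I0 /\ j \in I0.
Proof.
move=> Dd dij; split; rewrite inE; apply: contraNneq dij => E0.
  by rewrite -(ds_mul1 Dd) diagonal_mulE // E0 mul0r.
by rewrite -(ds_mulr1 Dd) mul_diagonalE // E0 mulr0.
Qed.

Lemma ds_support_nonempty : exists i, i \in I0.
Proof.
apply: contrapT => H; case/eqP: (ds_unit_neq0 D); apply/matrixP => i j.
rewrite mxE; apply/eqP; apply: contrapT => /negP eij; apply: H; exists i.
by case: (ds_entry_support (ds_unitP D) eij).
Qed.

(** The entry [c i i] divides [e i i = 1]. *)
Lemma diagonal_entry_neq0 c i : D c -> diagonal c -> c != 0 -> i \in I0 -> c i i != 0.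
Proof.
move=> Dc dc c0 iI; have [v _ [_ cv]] := dsV Dc c0.
apply: contraTneq iI => ci; rewrite inE negbK.
by have := diagonal_mulE v i i dc; rewrite cv ci mul0r => ->.
Qed.

Lemma diagonal_order u i k : D u -> diagonal u -> i \in I0 ->
  u i i ^+ k.+1 = 1 -> u ^+ k.+1 = e.
Proof.
move=> Du du iI uk; apply/eqP; rewrite -subr_eq0; apply/negP => /negP nz.
have Dd : D (u ^+ k.+1 - e) by apply: dsB; [apply: dsX|apply: ds_unitP].
have dd : diagonal (u ^+ k.+1 - e) by apply: diagonalB => //; apply: diagonalX.
have := diagonal_entry_neq0 Dd dd nz iI.
by rewrite mxE [X in _ + X]mxE diagonalXE // uk ds_unit_entry // subrr eqxx.
Qed.

(** To prove [Q] from a nonzero element supported in [P], one may assume that every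
    element of [D] with strictly smaller support is 0. *)
Lemma support_induction (P : pred ('I_n.+1 * 'I_n.+1)) (Q : Prop) :
  (forall d, D d -> d != 0 -> (forall i j, d i j != 0 -> P (i, j)) ->
     (forall d', D d' -> (forall i j, d' i j != 0 -> d i j != 0) ->
        (exists i j, d i j != 0 /\ d' i j = 0) -> d' = 0 \/ Q) ->
     Q) ->
  forall d, D d -> d != 0 -> (forall i j, d i j != 0 -> P (i, j)) -> Q.
Proof.
move=> step d; pose supp (c : M) := [set ij | c ij.1 ij.2 != 0].
have [k] := ubnP #|supp d|; elim: k d => // k IH d; rewrite ltnS => dk Dd d0 dP.
apply: (step d) => // d' Dd' sub [i [j [dij d'ij]]].
have [->|d'0] := eqVneq d' 0; [by left|right].
apply: (IH d') => // [|a b /sub]; last exact: dP.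
apply: leq_trans dk; apply: proper_card; apply/properP; split.
  by apply/fintype.subsetP => -[a b]; rewrite !inE; apply: sub.
by exists (i, j); rewrite !inE //= d'ij eqxx.
Qed.

End DiagonalElements.

(** * Diagonal elements of infinite order *)

(** Each factor raises the weight, which is bounded. *)
Lemma strictly_graded_nilpotent (K : fieldType) n (d : 'M[K]_n.+1) (w : 'I_n.+1 -> nat) :
  (forall i j, d i j != 0 -> (w i < w j)%N) -> exists k, d ^+ k.+1 = 0.
Proof.
move=> dw; have dkw k i j : (d ^+ k) i j != 0 -> (w i + k <= w j)%N.
  elim: k i j => [|k IH] i j.
    by rewrite addn0 mxE; case: (eqVneq i j) => [-> //|_]; rewrite eqxx.
  rewrite exprS mxE => nz; have [l] : exists l, d i l * (d ^+ k) l j != 0.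
    apply: contrapT => H; case/eqP: nz; rewrite big1 // => l _.
    by apply/eqP; apply: contrapT => /negP nl; apply: H; exists l.
  rewrite mulf_eq0 negb_or => /andP [/dw wil /IH wlj].
  by apply: leq_trans wlj; rewrite addnS ltn_add2r.
exists (\max_j w j); apply/matrixP => i j; rewrite [RHS]mxE; apply/eqP/negP => /negP.
move/dkw; rewrite leqNgt addnS ltnS; case/negP.
by apply: leq_trans (leq_bigmax j) _; rewrite leq_addl.
Qed.

(** Throughout, [u] is a diagonal element of [D] of infinite order, and [C] is the
    field of all diagonal elements of [D]. *)
Section InfiniteOrder.
Variables (K : closedFieldType) (n p : nat).
Hypothesis charp : p \in [pchar K].
Local Notation M := 'M[K]_n.+1.
Variable D : divisionSubring M.
Local Notation e := (ds_unit D).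
Hypothesis clD : zclosed (D : M -> Prop).
Variable u : M.
Hypotheses (Du : D u) (u0 : u != 0) (du : @diagonal K n u).
Hypothesis u_inf : forall k, u ^+ k.+1 != e.
Local Notation I0 := (ds_support D).

Let de : @diagonal K n e := ds_unit_diagonal Du u0 du.
Let C : set M := [set c | D c /\ @diagonal K n c]%classic.

Lemma eigenvalue_order i a b : i \in I0 -> u i i ^+ a = u i i ^+ b -> a = b.
Proof.
move=> iI; wlog ab : a b / (a <= b)%N => [W|].
  by case: (leqP a b) => [|/ltnW] ab E; [apply: W|apply/esym/W].
rewrite -(subnK ab); case: (b - a)%N => // k; rewrite exprD => /eqP.
rewrite -subr_eq0 -{1}[_ ^+ a]mul1r -mulrBl mulf_eq0 subr_eq0 expf_eq0.
rewrite (negPf (diagonal_entry_neq0 Du du u0 iI)) andbF orbF => /eqP/esym uk.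
by have := u_inf k; rewrite (diagonal_order de Du du iI uk) eqxx.
Qed.

(** Choose a minimal set [J] of positions such that every diagonal entry is a power
    of one at a position in [J]; the entries at [J] are then algebraically
    independent characters of [C].  A polynomial function vanishing on [D] therefore
    vanishes on every diagonal matrix obtained by assigning arbitrary values to
    the positions of [J], so all these matrices lie in [C].  As [C] has no zero
    divisors, [J] is a single position. *)
Lemma diagonal_entries_powers : exists (i0 : 'I_n.+1) (b : 'I_n.+1 -> nat),
  [/\ i0 \in I0, forall j, j \in I0 -> (0 < b j)%N,
      forall c j, C c -> j \in I0 -> c j j = c i0 i0 ^+ b j &
      forall t : K, C (\matrix_(i, j) if (i == j) && (i \in I0) then t ^+ b i else 0)].
Proof.
pose rel (j i : 'I_n.+1) := exists b, forall c, C c -> c j j = c i i ^+ b.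
have C0 : C 0 by split=> [|i j _]; [apply: ds0|rewrite mxE].
pose covers (J : {set 'I_n.+1}) :=
  (J \subset I0) && [forall j in I0, exists i in J, `[< rel j i >]].
have [|J /minsetP [/andP [JI /forall_inP cov] Jmin]] := @ex_minset _ covers.
  exists I0; rewrite /covers subxx; apply/forall_inP => j jI.
  by apply/exists_inP; exists j => //; apply/asboolP; exists 1%N.
have norel i i' b : i \in J -> i' \in J ->
    (forall c, C c -> c i i = c i' i' ^+ b) -> i = i'.
  move=> iJ i'J E; apply/eqP/negP => /negP ii'.
  have : J :\ i = J.
    apply: Jmin; last exact: subD1set.
    rewrite /covers (fintype.subset_trans (subD1set _ _) JI); apply/forall_inP => j jI.
    have /exists_inP [k kJ /asboolP [b' E']] := cov j jI.
    have [ki|ki] := eqVneq k i.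
      apply/exists_inP; exists i'; first by rewrite !inE eq_sym ii'.
      by apply/asboolP; exists (b * b')%N => c Cc; rewrite E' // ki E // exprM.
    by apply/exists_inP; exists k; [rewrite !inE ki|apply/asboolP; exists b'].
  by move/setP/(_ i); rewrite !inE eqxx iJ.
have relP j : exists ib : 'I_n.+1 * nat, j \in I0 ->
    [/\ ib.1 \in J, (0 < ib.2)%N & forall c, C c -> c j j = c ib.1 ib.1 ^+ ib.2].
  case: (boolP (j \in I0)) => jI; last by exists (j, 0%N).
  have /exists_inP [k kJ /asboolP [b E]] := cov j jI.
  exists (k, b) => _; split=> //=; rewrite lt0n; apply: contraTneq isT => b0 /=.
  by have := E 0 C0; rewrite b0 !mxE => /eqP; rewrite eq_sym oner_eq0.
have [rb rbP] := choice relP.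
have [i0 i0I] := ds_support_nonempty de.
(* h enumerates J, and r sends a position to the index of its representative. *)
have [i0J _ _] := rbP i0 i0I; set k0 := (rb i0).1 in i0J.
pose s := #|J|; pose h (k : 'I_s) : 'I_n.+1 := enum_val k.
pose r (j : 'I_n.+1) : 'I_s := enum_rank_in i0J (rb j).1.
have hJ k : h k \in J by apply: enum_valP.
have hI k : h k \in I0 by apply: (fintype.subsetP JI).
have hr j : j \in I0 -> h (r j) = (rb j).1.
  by move=> jI; rewrite /h /r enum_rankK_in //; case: (rbP j jI).
have rh k : r (h k) = k.
  apply: enum_val_inj; rewrite -/(h _) hr //; apply/esym.
  by have [? _ E] := rbP (h k) (hI k); apply: norel E.
pose z (t : 'I_s -> K) : M :=
  \matrix_(i, j) if (i == j) && (i \in I0) then t (r i) ^+ (rb i).2 else 0.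
have zdiag t : @diagonal K n (z t) by move=> i j ij; rewrite mxE (negPf ij).
have Cz t : C (z t).
  split; last exact: zdiag.
  apply: clD => f pf f0.
  have [|g gE] := polyfun_mpoly (z := z) _ pf.
    move=> i j; case: (boolP ((i == j) && (i \in I0))) => ij.
      by exists ('X_(r i) ^+ (rb i).2) => t'; rewrite rmorphXn /= mevalXU mxE ij.
    by exists 0 => t'; rewrite meval0 mxE (negPf ij).
  rewrite gE; suff -> : g = 0 by rewrite meval0.
  apply: (@characters_algebraically_independent M K p charp C e s
     (fun k c => c (h k) (h k))).
  - by split=> //; apply: ds_unitP.
  - move=> x y [Dx dx] [Dy dy]; split; first exact: dsD.
    by rewrite -[y]opprK -[- y]sub0r; do 2?[apply: diagonalB => //]; move=> ? ? _; rewrite mxE.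
  - by move=> x y [Dx dx] [Dy dy]; split; [apply: dsM|apply: diagonalM].
  - by move=> k; apply: ds_unit_entry.
  - by move=> k x y _ _; rewrite mxE.
  - by move=> k x y [_ dx] _; rewrite diagonal_mulE.
  - move=> k a b' E; apply: (eigenvalue_order (hI k)); exact: E.
  - by move=> k k' b' E; apply: enum_val_inj; apply: norel E.
  move=> c [Dc dc]; rewrite -gE; apply: f0; suff -> : z (fun k => c (h k) (h k)) = c by [].
  apply/matrixP => i j; rewrite mxE; case: (eqVneq i j) => [<-|ij] /=; last by rewrite dc.
  case: (boolP (i \in I0)) => iI.
    by rewrite hr //; have [_ _ ->] := rbP i iI.
  apply/esym/eqP; apply: contraNT iI => ci.
  by case: (ds_entry_support de Dc ci).
(* Two positions in J would give the zero divisors z (one_at k), z (one_at k'). *)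
have rconst (k k' : 'I_s) : k = k'.
  apply/eqP/negP => /negP kk'.
  pose one_at (l : 'I_s) : 'I_s -> K := fun l' => (l' == l)%:R.
  have z0 l : z (one_at l) <> 0.
    move/matrixP/(_ (h l) (h l)); rewrite !mxE eqxx hI /= rh /one_at eqxx expr1n => /eqP.
    by rewrite oner_eq0.
  have [Dk _] := Cz (one_at k); have [Dk' _] := Cz (one_at k').
  have zz : z (one_at k) * z (one_at k') = 0.
    apply/matrixP => i j; rewrite diagonal_mulE // !mxE eqxx /=.
    case: (boolP (i \in I0)) => iI; last by rewrite mul0r.
    case: eqP => [_|_]; last by rewrite mulr0.
    have [_ bi _] := rbP i iI; rewrite /one_at.
    have [->|rk] := eqVneq (r i) k; first by rewrite (negPf kk') expr0n eqn0Ngt bi mulr0.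
    by rewrite expr0n eqn0Ngt bi mul0r.
  by case: (ds_mul_eq0 Dk Dk' zz) => /z0.
exists k0, (fun j => (rb j).2); split.
- exact: (fintype.subsetP JI).
- by move=> j jI; case: (rbP j jI).
- move=> c j Cc jI; have [_ _ ->] := rbP j jI => //.
  by rewrite -hr // (rconst (r j) (r i0)) hr.
move=> t; exact: (Cz (fun=> t)).
Qed.

(** The entries of [c * d - d * c] vanish where [b i = b j].  It thus suffices that
    no nonzero element [d'] of [D] is supported where [b i != b j].  Fix a position
    [(i1, j1)] of a smallest such support.  Left multiplication by
    [z (mu ^+ b j1)] and right multiplication by [z (mu ^+ b i1)] act equally
    there, so their difference has smaller support and is 0: the ratio of [b i] to
    [b j] is the same, and different from 1, on the whole support.  This makes [d']
    nilpotent. *)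
Lemma diagonal_central c d : D c -> @diagonal K n c -> D d -> c * d = d * c.
Proof.
have [i0 [b [i0I b0 bE zP]]] := diagonal_entries_powers.
pose z t : M := \matrix_(i, j) if (i == j) && (i \in I0) then t ^+ b i else 0.
have Dz t : D (z t) by case: (zP t).
have zd t : @diagonal K n (z t) by case: (zP t).
have zE t i : i \in I0 -> z t i i = t ^+ b i by move=> iI; rewrite mxE eqxx iI.
have off d' : D d' -> (forall i j, d' i j != 0 -> b i != b j) -> d' = 0.
  move=> Dd' offd'; apply/eqP/negP => /negP d'0.
  apply: (@support_induction K n D (fun ij => b ij.1 != b ij.2) False _ d') => //.
  move=> {offd' d'0}{}d' {}Dd' d'0 offd' minsupp.
  have [i1 [j1 d1]] : exists i j, d' i j != 0.
    apply: contrapT => H; case/eqP: d'0; apply/matrixP => i j; rewrite mxE.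
    by apply/eqP; apply: contrapT => /negP nz; apply: H; exists i, j.
  pose mu := u i0 i0.
  pose g := z (mu ^+ b j1) * d' - d' * z (mu ^+ b i1).
  have gE i j : d' i j != 0 ->
      g i j = (mu ^+ (b j1 * b i) - mu ^+ (b i1 * b j)) * d' i j.
    move=> dij; have [iI jI] := ds_entry_support de Dd' dij.
    rewrite mxE [X in _ + X]mxE diagonal_mulE // mul_diagonalE // !zE // -!exprM.
    by rewrite mulrBl [X in _ - X]mulrC.
  have Dg : D g by apply: dsB; apply: dsM.
  have prop i j : d' i j != 0 -> (b j1 * b i = b i1 * b j)%N.
    move=> dij; case: (minsupp g) => //.
    - move=> k l; apply: contraNneq => dkl.
      by rewrite mxE [X in _ + X]mxE diagonal_mulE // mul_diagonalE // dkl mul0r mulr0 subr0.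
    - by exists i1, j1; split=> //; rewrite gE // mulnC subrr mul0r.
    move/matrixP/(_ i j); rewrite gE // mxE => /eqP.
    rewrite mulf_eq0 (negPf dij) orbF subr_eq0 => /eqP.
    exact: eigenvalue_order.
  have [i1I j1I] := ds_entry_support de Dd' d1.
  have [k] : exists k, d' ^+ k.+1 = 0.
    have := offd' _ _ d1; rewrite /= neq_ltn => /orP [] lt_b.
      apply: (@strictly_graded_nilpotent _ _ _ b) => i j dij.
      have [iI jI] := ds_entry_support de Dd' dij.
      by rewrite -(ltn_pmul2l (b0 j1 j1I)) (prop i j dij) ltn_pmul2r ?b0.
    apply: (@strictly_graded_nilpotent _ _ _ (fun i => \max_k b k - b i)%N) => i j dij.
    have [iI jI] := ds_entry_support de Dd' dij.
    apply: ltn_sub2l; last first.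
      by rewrite -(ltn_pmul2l (b0 i1 i1I)) -(prop i j dij) ltn_pmul2r ?b0.
    apply: leq_trans (leq_bigmax i).
    by rewrite -(ltn_pmul2l (b0 i1 i1I)) -(prop i j dij) ltn_pmul2r ?b0.
  by move/eqP; rewrite (negPf (dsX_neq0 k Dd' d'0)).
move=> Dc dc Dd; apply/eqP; rewrite -subr_eq0; apply/eqP; apply: off.
  by apply: dsB; apply: dsM.
move=> i j; rewrite mxE [X in _ + X]mxE diagonal_mulE // mul_diagonalE //.
rewrite [d i j * _]mulrC -mulrBl mulf_eq0 negb_or => /andP [cij dij].
have [iI jI] := ds_entry_support de Dd dij.
by apply: contraNneq cij => bij; rewrite (bE c i) // (bE c j) // bij subrr.
Qed.

(** As [s] runs over [K], the field [C] contains a [p^N]-th root [y] of [u]; it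
    commutes with [x], so [x - y] is nilpotent, hence [x = y]. *)
Lemma pth_root_of_diagonal N x : D x -> x ^+ (p ^ N) = u ->
  forall d, D d -> x * d = d * x.
Proof.
move=> Dx xu; have [i0 [b [i0I b0 bE zP]]] := diagonal_entries_powers.
have q0 : (0 < p ^ N)%N by rewrite expn_gt0 prime_gt0 // (pcharf_prime charp).
have [s sq] : exists s : K, s ^+ (p ^ N) = u i0 i0.
  have : size ('X^(p ^ N) - (u i0 i0)%:P) != 1%N by rewrite size_XnsubC // eqSS -lt0n.
  by case/closed_rootP => s; rewrite rootE !hornerE subr_eq0 => /eqP; exists s.
have [] := zP s; set y := (X in D X) => Dy dy.
suff -> : x = y by move=> d Dd; apply: diagonal_central.
have yq : y ^+ (p ^ N) = u.
  apply/matrixP => i j; have [<-|ij] := eqVneq i j; last by rewrite du // diagonalX.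
  rewrite diagonalXE // mxE eqxx /=; case: (boolP (i \in I0)) => iI.
    by rewrite -exprM mulnC exprM sq -(bE u).
  rewrite expr0n eqn0Ngt q0 /=; apply/esym/eqP; apply: contraNT iI => ui.
  by case: (ds_entry_support de Du ui).
have := exprB_pchar_comm N (pchar_matrix n charp) (esym (diagonal_central Dy dy Dx)).
rewrite xu yq subrr => /eqP; case: (p ^ N)%N q0 => // q _.
apply: contraTeq; rewrite -subr_eq0; exact: (dsX_neq0 q (dsB Dx Dy)).
Qed.

End InfiniteOrder.

(** * Elements of infinite order are central *)

Section Conjugation.
Variables (R : unitRingType) (D : divisionSubring R) (P : R).
Hypothesis Pu : P \is a GRing.unit.

Let cj x := P * x * P^-1.
Let uncj x := P^-1 * x * P.
Let cjK : cancel cj uncj.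
Proof. by move=> x; rewrite /cj /uncj !mulrA mulVr // mul1r -mulrA mulVr // mulr1. Qed.
Let uncjK : cancel uncj cj.
Proof. by move=> x; rewrite /cj /uncj !mulrA divrr // mul1r mulrK. Qed.
Let uncjM x y : uncj (x * y) = uncj x * uncj y.
Proof. by rewrite /uncj !mulrA mulrK. Qed.
Let uncjB x y : uncj (x - y) = uncj x - uncj y.
Proof. by rewrite /uncj mulrBr mulrBl. Qed.
Let uncj_inj : injective uncj := can_inj uncjK.

(** The division ring [P * D * P^-1]. *)
Program Definition conj_division : divisionSubring R :=
  @DivisionSubring R (fun x => D (uncj x)) (cj (ds_unit D)) _ _ _ _ _ _ _.
Next Obligation. rewrite cjK; exact: ds_unitP. Qed.
Next Obligation.
apply: contra_neq (ds_unit_neq0 D) => E; rewrite -[LHS]cjK E.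
by rewrite /uncj mulr0 mul0r.
Qed.
Next Obligation. by rewrite uncjB; apply: dsB. Qed.
Next Obligation. by rewrite uncjM; apply: dsM. Qed.
Next Obligation. by apply: uncj_inj; rewrite uncjM cjK ds_mul1. Qed.
Next Obligation. by apply: uncj_inj; rewrite uncjM cjK ds_mulr1. Qed.
Next Obligation.
have [|v Dv [vx xv]] := dsV H.
  by apply: contra_neq H0 => E; rewrite -[x]uncjK E /cj mulr0 mul0r.
exists (cj v); first by rewrite cjK.
by split; apply: uncj_inj; rewrite uncjM !cjK.
Qed.

Lemma conj_divisionP x : D x -> conj_division (P * x * P^-1).
Proof. by move=> Dx /=; rewrite -/(cj x) cjK. Qed.

End Conjugation.

Lemma conjX (R : unitRingType) (P x : R) k : P \is a GRing.unit ->
  (P * x * P^-1) ^+ k = P * x ^+ k * P^-1.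
Proof.
move=> Pu; elim: k => [|k IH]; first by rewrite !expr0 mulr1 divrr.
by rewrite !exprS IH !mulrA mulrVK.
Qed.

Section PositiveCharacteristic.
Variables (K : closedFieldType) (n p : nat).
Hypothesis charp : p \in [pchar K].
Local Notation M := 'M[K]_n.+1.
Variable D : divisionSubring M.
Local Notation e := (ds_unit D).

Lemma conj_division_closed (P : M) (Pu : P \is a GRing.unit) :
  zclosed (D : M -> Prop) -> zclosed (conj_division D Pu : M -> Prop).
Proof.
move=> clD.
exact: (@zclosed_preimage K M M (mulmxr P \o mulmx (invmx P)) (D : M -> Prop) clD).
Qed.

Lemma infinite_order_central x d : zclosed (D : M -> Prop) ->
  D x -> x != 0 -> (forall k, x ^+ k.+1 != e) -> D d -> x * d = d * x.
Proof.
move=> clD Dx x0 x_inf Dd.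
have nq : (n < p ^ n.+1)%N.
  by apply: ltn_trans (ltnSn n) _; rewrite ltn_expl // prime_gt1 // (pcharf_prime charp).
have [P Pm Pd] := diagonalizable_pexp x charp nq.
have Pu : P \is a GRing.unit := Pm.
have inj : injective (fun y : M => P * y * P^-1).
  have Pvu : P^-1 \is a GRing.unit by rewrite unitrV.
  by move=> y z E; apply: (mulrI Pu); apply: (mulIr Pvu).
apply: (inj); pose D' := conj_division D Pu.
set q := (p ^ n.+1)%N in nq Pd.
have q0 : (0 < q)%N by apply: leq_ltn_trans nq.
have Dq : D (x ^+ q) by rewrite -(prednK q0); apply: dsX.
have xq0 : x ^+ q != 0 by rewrite -(prednK q0) (dsX_neq0 _ Dx).
pose cj y := P * y * P^-1.
have cjM y z : cj (y * z) = cj y * cj z by rewrite /cj !mulrA mulrVK.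
rewrite -!/(cj _) !cjM.
apply: (@pth_root_of_diagonal K n p charp D' _ (cj (x ^+ q)) _ _ _ _ n.+1).
- exact: conj_division_closed.
- exact: conj_divisionP.
- by apply: contra_neq xq0 => E; apply: (inj); rewrite /= -/(cj _) E mulr0 mul0r.
- by move=> i j ij; move/is_diag_mxP: Pd; apply.
- move=> k; rewrite conjX // -exprM.
  apply: contraNneq (x_inf (q * k.+1).-1) => E.
  by apply/eqP/inj; rewrite prednK ?muln_gt0 ?q0 // E.
- exact: conj_divisionP.
- by rewrite conjX.
- exact: conj_divisionP.
Qed.

End PositiveCharacteristic.

(** * Finite rings generated by a twisted pair *)

(** If [d * x = x ^+ k.+1 * d] and both have finite order, every sum of the monomials
    [x ^+ a.+1 * d ^+ b.+1] reduces to one with bounded exponents and with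
    coefficients less than [p].  Hence these sums form a finite ring [G]; inverses
    are powers.  Exponents start at 1 because the unit of [D] is [e], not 1. *)
Section TwistedFiniteSubring.
Variables (R : nzRingType) (D : divisionSubring R) (p : nat).
Local Notation e := (ds_unit D).
Hypothesis p0 : p%:R = 0 :> R.
Hypothesis p_gt0 : (0 < p)%N.
Variables (x d : R) (k m r : nat).
Hypotheses (Dx : D x) (Dd : D d).
Hypothesis fin : forall y, D y -> y != 0 -> exists j, y ^+ j.+1 = e.
Hypotheses (xm : x ^+ m.+1 = e) (dr : d ^+ r.+1 = e).
Hypothesis twist : d * x = x ^+ k.+1 * d.

Let w (t : nat * nat) := x ^+ t.1.+1 * d ^+ t.2.+1.
Let G (y : R) := exists l : seq (nat * nat), y = \sum_(t <- l) w t.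

Let GD y : G y -> D y.
Proof.
case=> l ->; elim: l => [|t l IH]; first by rewrite big_nil; apply: ds0.
by rewrite big_cons; apply: dsD => //; apply: dsM; apply: dsX.
Qed.

Let Gadd y z : G y -> G z -> G (y + z).
Proof. by move=> [l ->] [l' ->]; exists (l ++ l'); rewrite big_cat. Qed.

Let Gmuln y j : G y -> G (y *+ j).
Proof.
move=> Gy; elim: j => [|j IH]; first by exists [::]; rewrite big_nil.
by rewrite mulrS; apply: Gadd.
Qed.

Let Gopp y : G y -> G (- y).
Proof.
move=> Gy; suff -> : - y = y *+ p.-1 by apply: Gmuln.
apply/eqP; rewrite eq_sym -addr_eq0 -mulrSr prednK //.
by rewrite -mulr_natr p0 mulr0.
Qed.

Let dxi i : d * x ^+ i = x ^+ (k.+1 * i) * d.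
Proof.
elim: i => [|i IH]; first by rewrite muln0 mulr1 mul1r.
by rewrite exprS mulrA twist -mulrA IH mulrA -exprD mulnS.
Qed.

Let djxi j i : d ^+ j * x ^+ i = x ^+ (k.+1 ^ j * i) * d ^+ j.
Proof.
elim: j i => [|j IH] i; first by rewrite mul1n mulr1 mul1r.
by rewrite exprSr -mulrA dxi mulrA IH -mulrA -exprSr mulnA expnSr.
Qed.

Let ww t t' : exists t'', w t * w t' = w t''.
Proof.
case: t t' => a b [c f]; rewrite /w /=.
exists (a + k.+1 ^ b.+1 * c.+1, b + f.+1)%N => /=.
rewrite mulrA -[x ^+ a.+1 * _ * _]mulrA djxi mulrA -exprD -mulrA -exprD.
by rewrite addSn addSn.
Qed.

Let Gmul y z : G y -> G z -> G (y * z).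
Proof.
move=> [l ->] [l' ->]; elim: l => [|t l IH].
  by rewrite big_nil mul0r; exists [::]; rewrite big_nil.
rewrite big_cons mulrDl; apply: Gadd => //.
elim: l' {IH} => [|t' l' IH'].
  by rewrite big_nil mulr0; exists [::]; rewrite big_nil.
rewrite big_cons mulrDr; apply: Gadd => //.
by have [t'' ->] := ww t t'; exists [:: t'']; rewrite big_seq1.
Qed.

Let GX y j : G y -> G (y ^+ j.+1).
Proof. by move=> Gy; elim: j => [|j IH]; rewrite ?expr1 // exprS; apply: Gmul. Qed.

Let Gw t : G (w t). Proof. by exists [:: t]; rewrite big_seq1. Qed.

Let Ge : G e.
Proof. by have := Gw (m, r); rewrite /w /= xm dr ds_mul1 //; apply: ds_unitP. Qed.
Let Gx : G x.
Proof.
have := Gw (m.+1, r); rewrite /w /= dr exprS xm (ds_mulr1 Dx).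
by rewrite (ds_mulr1 Dx).
Qed.
Let Gd : G d.
Proof.
by have := Gw (m, r.+1); rewrite /w /= xm exprS dr (ds_mulr1 Dd) (ds_mul1 Dd).
Qed.

Let period z j a q : D z -> z ^+ j.+1 = e -> z ^+ (q * j.+1 + a).+1 = z ^+ a.+1.
Proof.
move=> Dz zj; elim: q => [|q IH] //.
by rewrite mulSn -addnA -addnS exprD IH zj ds_mul1 //; apply: dsX.
Qed.

Let wmod t : w t = w (t.1 %% m.+1, t.2 %% r.+1)%N.
Proof. by rewrite /w {1}(divn_eq t.1 m.+1) {1}(divn_eq t.2 r.+1) !period. Qed.

Let T : finType := ('I_m.+1 * 'I_r.+1)%type.
Let wT (t : T) := w (nat_of_ord t.1, nat_of_ord t.2).

Let Gcount y : G y -> exists c : T -> nat, y = \sum_t wT t *+ c t.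
Proof.
case=> l ->; elim: l => [|t l [c IH]].
  by exists (fun=> 0%N); rewrite big_nil big1.
pose t0 : T := (Ordinal (ltn_pmod t.1 (ltn0Sn m)), Ordinal (ltn_pmod t.2 (ltn0Sn r))).
exists (fun t => c t + (t == t0))%N; rewrite big_cons IH addrC.
under [RHS]eq_bigr do rewrite mulrnDr.
rewrite big_split /=; congr (_ + _); rewrite (bigD1 t0) //= eqxx big1 ?addr0.
  by rewrite wmod.
by move=> t1 /negPf ->.
Qed.

Let elements : seq R :=
  [seq \sum_t wT t *+ g t | g : {ffun T -> 'I_p}].

Let Gelements y : G y -> y \in elements.
Proof.
move=> /Gcount [c ->]; apply/mapP.
exists [ffun t => Ordinal (ltn_pmod (c t) p_gt0)]; first by rewrite mem_enum.
apply: eq_bigr => t _; rewrite ffunE /= {1}(divn_eq (c t) p) mulrnDr mulrnA.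
by rewrite -[X in X + _]mulr_natr p0 mulr0 add0r.
Qed.

Let Gsub y z : G y -> G z -> G (y - z).
Proof. by move=> Gy Gz; apply: Gadd => //; apply: Gopp. Qed.
Let Gmul1 y : G y -> e * y = y.
Proof. by move=> Gy; apply: ds_mul1; apply: GD. Qed.
Let Gmulr1 y : G y -> y * e = y.
Proof. by move=> Gy; apply: ds_mulr1; apply: GD. Qed.
Let Ginv y : G y -> y != 0 -> exists2 z, G z & z * y = e /\ y * z = e.
Proof.
move=> Gy y0; have [j yj] := fin (GD Gy) y0.
(* Since j may be 0, the exponent j of the inverse is increased by a period to
   keep it positive. *)
exists (y ^+ (j + j).+1); first exact: GX.
suff E : y ^+ (j + j).+2 = e by rewrite -exprSr -exprS.
by rewrite -addSn -addnS exprD yj ds_mul1 //; apply: ds_unitP.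
Qed.

Let generated := DivisionSubring Ge (ds_unit_neq0 D) Gsub Gmul Gmul1 Gmulr1 Ginv.

Lemma twisted_finite_comm : x * d = d * x.
Proof. exact: (@finite_division_subring_comm R generated elements Gelements x d Gx Gd). Qed.

End TwistedFiniteSubring.

(** * Closed division subrings are commutative *)

Section FiniteOrder.
Variables (K : closedFieldType) (n p : nat).
Hypothesis charp : p \in [pchar K].
Local Notation M := 'M[K]_n.+1.

(** If [p] divided the order [m], then [x ^+ (m %/ p) - e] would be nilpotent. *)
Lemma minimal_order_pprime (D : divisionSubring M) x m : D x -> (0 < m)%N ->
  x ^+ m = ds_unit D ->
  (forall k, x ^+ k.+1 = ds_unit D -> (m <= k.+1)%N) -> coprime p m.
Proof.
move=> Dx m0 xm mmin; rewrite prime_coprime ?(pcharf_prime charp) //.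
apply/negP => /dvdnP [[|m1] mE]; first by rewrite mE in m0.
have p1 := prime_gt1 (pcharf_prime charp).
set e := ds_unit D in xm mmin *; have De : D e := ds_unitP D.
have xm1 : x ^+ m1.+1 = e.
  apply/eqP; rewrite -subr_eq0; apply/negP => /negP nz.
  have Dz : D (x ^+ m1.+1 - e) by apply: dsB => //; apply: dsX.
  have := exprB_pchar_comm 1 (pchar_matrix n charp) (x := x ^+ m1.+1) (y := e).
  rewrite ds_mul1 ?ds_mulr1; try exact: dsX.
  move/(_ erefl); rewrite expn1 -exprM -mE xm -(prednK (ltnW p1)) ds_unitX subrr.
  by move/eqP; rewrite (negPf (dsX_neq0 _ Dz nz)).
by have := mmin _ xm1; rewrite mE leqNgt ltn_Pmulr.
Qed.

(** The entries of [x] on the support of [D] are primitive [m]-th roots of unity, so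
    [x j j] is a power of [x i i].  Among the nonzero elements supported where
    [x i i != x j j], such as [x * y - y * x], an element [d] of smallest support
    satisfies [d * x = x ^+ l.+1 * d] as soon as this holds at one position of its
    support. *)
Lemma diagonal_twist (D : divisionSubring M) x y m :
  D x -> D y -> x != 0 -> @diagonal K n x -> (0 < m)%N -> x ^+ m = ds_unit D ->
  (forall k, x ^+ k.+1 = ds_unit D -> (m <= k.+1)%N) -> x * y <> y * x ->
  exists k d, [/\ D d, d != 0, d * x = x ^+ k.+1 * d & x ^+ k.+1 != x].
Proof.
move=> Dx Dy x0 dx m0 xm mmin xy; have de := ds_unit_diagonal Dx x0 dx.
have xim i : i \in ds_support D -> x i i ^+ m = 1.
  by move=> iI; rewrite -diagonalXE // xm ds_unit_entry.
have prim i : i \in ds_support D -> m.-primitive_root (x i i).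
  move=> iI; have [m' m'prim m'm] := prim_order_exists m0 (xim i iI).
  suff -> : m = m' by [].
  apply/eqP; rewrite eqn_leq (dvdn_leq m0 m'm) andbT.
  have := prim_expr_order m'prim; have := prim_order_gt0 m'prim.
  by case: (m') => // k _ /(diagonal_order de Dx dx iI)/mmin.
have Dc : D (x * y - y * x) by apply: dsB; apply: dsM.
have c0 : x * y - y * x != 0 by rewrite subr_eq0; apply/eqP.
apply: (@support_induction K n D (fun ij => x ij.1 ij.1 != x ij.2 ij.2) _ _ _ Dc c0); last first.
  move=> i j; rewrite mxE [X in _ + X]mxE diagonal_mulE // mul_diagonalE //=.
  by apply: contraNneq => ->; rewrite mulrC subrr.
move=> d Dd d0 dP minsupp; have [i [j dij]] : exists i j, d i j != 0.
  apply: contrapT => H; case/eqP: d0; apply/matrixP => i j; rewrite mxE.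
  by apply/eqP; apply: contrapT => /negP nz; apply: H; exists i, j.
have [iI jI] := ds_entry_support de Dd dij.
have [[k km] xj] := prim_rootP (prim i iI) (xim j jI); rewrite /= in xj.
have {}xj : x j j = x i i ^+ (k + m.-1).+1.
  by rewrite -addnS prednK // exprD xim // mulr1.
set l := (k + m.-1)%N in xj.
case: (minsupp (x ^+ l.+1 * d - d * x)).
- by apply: dsB; apply: dsM => //; apply: dsX.
- move=> a b; apply: contraNneq => dab; rewrite mxE [X in _ + X]mxE.
  have dxl := diagonalX l.+1 dx.
  by rewrite (diagonal_mulE _ _ _ dxl) (mul_diagonalE _ _ _ dx) dab mulr0 mul0r subr0.
- exists i, j; split=> //; rewrite mxE [X in _ + X]mxE.
  rewrite (diagonal_mulE _ _ _ (diagonalX l.+1 dx)) (mul_diagonalE _ _ _ dx).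
  by rewrite diagonalXE // -xj mulrC subrr.
- move/eqP; rewrite subr_eq0 => /eqP E; exists l, d; split=> //.
  apply: contraNneq (dP i j dij) => xl /=.
  by rewrite xj -diagonalXE // xl eqxx.
by [].
Qed.

(** As the order [m] of [x] is prime to [p], some power [p^N] is congruent to 1 modulo
    [m] and exceeds the size, so [x = x ^+ (p ^ N)] is diagonalizable, and
    [diagonal_twist] applies in a basis of eigenvectors. *)
Lemma finite_order_comm (D : divisionSubring M) :
  (forall y, D y -> y != 0 -> exists k, y ^+ k.+1 = ds_unit D) ->
  forall x y, D x -> D y -> x * y = y * x.
Proof.
move=> fin x y Dx Dy; apply: contrapT => xy.
have x0 : x != 0 by apply/eqP => x0; apply: xy; rewrite x0 mul0r mulr0.
have [k0 xk0] := fin x Dx x0.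
have exm : exists k, x ^+ k.+1 == ds_unit D by exists k0; apply/eqP.
case: (ex_minnP exm) => m' /eqP xm min'; pose m := m'.+1.
have mmin k : x ^+ k.+1 = ds_unit D -> (m <= k.+1)%N by move/eqP/min'.
have cop := minimal_order_pprime Dx (ltn0Sn m') xm mmin.
pose N := (totient m * n.+1)%N.
have p1 := prime_gt1 (pcharf_prime charp).
have nq : (n < p ^ N)%N.
  apply: leq_ltn_trans (ltn_expl N p1); rewrite /N -[n in (n <= _)%N]mul1n.
  by apply: leq_mul => //; rewrite totient_gt0.
have xq : x ^+ (p ^ N) = x.
  have q1 : (p ^ N = 1 %[mod m])%N.
    rewrite expnM -modnXm Euler_exp_totient // modnXm exp1n //.
  have q_gt0 : (0 < p ^ N)%N by rewrite expn_gt0 (ltnW p1).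
  have /dvdnP [c cE] : (m %| p ^ N - 1)%N by rewrite -eqn_mod_dvd //; apply/eqP.
  rewrite -(subnK q_gt0) cE exprD expr1 mulnC exprM xm.
  by case: c cE => [|c] _; rewrite ?expr0 ?mul1r // ds_unitX ds_mul1.
have [P Pm Pd] := diagonalizable_pexp x charp nq; rewrite xq in Pd.
have Pu : P \is a GRing.unit := Pm.
have Pvu : P^-1 \is a GRing.unit by rewrite unitrV.
pose cj (z : M) := P * z * P^-1.
have inj : injective cj by move=> a b E; apply: (mulrI Pu); apply: (mulIr Pvu).
have cjM a b : cj (a * b) = cj a * cj b by rewrite /cj !mulrA mulrVK.
have cj0 z : z != 0 -> cj z != 0.
  by apply: contra_neq => E; apply: (inj); rewrite E /cj mulr0 mul0r.
pose D' := conj_division D Pu.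
have [||||||||k [d [D'd d0 dx xk]]] := @diagonal_twist D' (cj x) (cj y) m.
- exact: conj_divisionP.
- exact: conj_divisionP.
- exact: cj0.
- by move=> i j ij; move/is_diag_mxP: Pd; apply.
- by [].
- by rewrite /cj conjX // xm.
- by move=> k; rewrite /cj conjX // => /inj/mmin.
- by rewrite -!cjM => /inj.
have D'x : D' (cj x) by apply: conj_divisionP.
have fin' z : D' z -> z != 0 -> exists j, z ^+ j.+1 = ds_unit D'.
  move=> D'z z0; have zE : z = cj (P^-1 * z * P).
    by rewrite /cj !mulrA divrr // mul1r mulrK.
  have [|j zj] := fin _ D'z; first by apply: contra_neq z0 => E; rewrite zE E /cj mulr0 mul0r.
  by exists j; rewrite zE /cj conjX // zj.
have [r dr] := fin' d D'd d0.
have x'm : cj x ^+ m'.+1 = ds_unit D' by rewrite /cj conjX // xm.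
have pM : p%:R = 0 :> M by apply/eqP; case/andP: (pchar_matrix n charp).
have com := twisted_finite_comm pM (ltnW p1) D'x D'd fin' x'm dr dx.
move: xk; rewrite -subr_eq0 => /negP; apply; apply/eqP.
have Dz : D' (cj x ^+ k.+1 - cj x) by apply: dsB => //; apply: dsX.
case: (ds_mul_eq0 Dz D'd) => // [|d00]; last by rewrite d00 eqxx in d0.
by rewrite mulrBl -dx com subrr.
Qed.

(** If some [x] has infinite order, it is central, and so is every [y] of infinite
    order; for [y] of finite order, [x * y] has infinite order, and [y] is central
    as well. *)
Lemma pchar_division_comm (D : divisionSubring M) : zclosed (D : M -> Prop) ->
  forall x y, D x -> D y -> x * y = y * x.
Proof.
move=> clD; set e := ds_unit D.
have [[x [Dx x0 x_inf]]|fin] :=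
  pselect (exists x, [/\ D x, x != 0 & forall k, x ^+ k.+1 != e]).
  have cx y : D y -> x * y = y * x.
    by move=> Dy; exact: (infinite_order_central charp clD Dx x0 x_inf Dy).
  suff cen y z : D y -> D z -> y * z = z * y by [].
  move=> Dy Dz; have [->|y0] := eqVneq y 0; first by rewrite mul0r mulr0.
  have [y_inf|] := pselect (forall k, y ^+ k.+1 != e).
    exact: (infinite_order_central charp clD).
  move=> y_fin; have [k /eqP yk] : exists k, y ^+ k.+1 == e.
    by apply: contrapT => H; apply: y_fin => k; apply/negP => E; apply: H; exists k.
  have Dxy := dsM Dx Dy.
  have xyX j : (x * y) ^+ j = x ^+ j * y ^+ j by apply: exprMn_comm; apply: cx.
  have xy0 : x * y != 0.
    by apply/eqP => /(ds_mul_eq0 Dx Dy) [] E; [rewrite E eqxx in x0|rewrite E eqxx in y0].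
  have xy_inf j : (x * y) ^+ j.+1 != e.
    apply/eqP => E; have := x_inf (j.+1 * k.+1).-1; rewrite prednK //.
    have : (x * y) ^+ (j.+1 * k.+1) = e by rewrite exprM E ds_unitX.
    rewrite xyX [in y ^+ _]mulnC [y ^+ _]exprM yk ds_unitX ds_mulr1 => [->|].
      by rewrite eqxx.
    by rewrite -[(j.+1 * k.+1)%N]prednK //; apply: dsX.
  have cxy := infinite_order_central charp clD Dxy xy0 xy_inf Dz.
  apply/eqP; rewrite -subr_eq0; apply/eqP.
  have Dc : D (y * z - z * y) by apply: dsB; apply: dsM.
  case: (ds_mul_eq0 Dx Dc) => // [|x00]; last by rewrite x00 eqxx in x0.
  by rewrite mulrBr !mulrA cxy (cx z) // mulrA subrr.
move=> x y; apply: finite_order_comm => z Dz z0.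
apply: contrapT => H; apply: fin; exists z; split=> // k.
by apply/eqP => E; apply: H; exists k.
Qed.

End FiniteOrder.

Theorem closed_division_comm (K : closedFieldType) n (D : divisionSubring 'M[K]_n.+1) :
  zclosed (D : 'M[K]_n.+1 -> Prop) -> forall x y, D x -> D y -> x * y = y * x.
Proof.
have [[p charp]|ch0] := pselect (exists p, p \in [pchar K]).
  exact: (pchar_division_comm charp).
apply: pchar0_division_comm => m; apply/negP => m0; apply: ch0.
by have [p charp] := natf0_pchar (ltn0Sn m) m0; exists p.
Qed.

(** * Matrix units *)

Section MatrixUnits.
Variables (K : closedFieldType) (n : nat).
Local Notation M := 'M[K]_n.+1.
Variable A : set M.
Hypotheses (srA : subrng A) (clA : zclosed A) (spA : semiprime_rng A).

Let AM x y : A x -> A y -> A (x * y). Proof. by case: srA => _ _; apply. Qed.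
Let AD x y : A x -> A y -> A (x + y). Proof. exact: subrngD. Qed.

Lemma corner_field e : primitive_idempotent A e ->
  exists D : fieldSubring M, ds_unit D = e /\
    forall x, D x <-> [/\ A x, e * x = x & x * e = x].
Proof.
move=> prim_e; have [Ae e0 ee _] := prim_e; have [A0 AB _] := srA.
pose S x := [/\ A x, e * x = x & x * e = x].
have Se : S e by [].
have SB x y : S x -> S y -> S (x - y).
  move=> [Ax ex xe] [Ay ey ye]; split; first exact: AB.
    by rewrite mulrBr ex ey.
  by rewrite mulrBl xe ye.
have SM x y : S x -> S y -> S (x * y).
  move=> [Ax ex xe] [Ay ey ye]; split; first exact: AM.
    by rewrite mulrA ex.
  by rewrite -mulrA ye.
have S1 x : S x -> e * x = x by case.
have S1r x : S x -> x * e = x by case.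
have SV x : S x -> x != 0 -> exists2 y, S y & y * x = e /\ x * y = e.
  move=> [Ax ex xe] x0.
  have [v [Av ev ve vx xv]] :=
    primitive_invertible srA clA spA prim_e prim_e Ax x0 ex xe.
  by exists v.
pose D := DivisionSubring Se e0 SB SM S1 S1r SV.
have clD : zclosed (D : M -> Prop).
  have -> : (D : M -> Prop) = (A `&` ([set x | mulmx (1 - e) x = 0] `&`
      [set x | mulmxr (1 - e) x = 0]))%classic.
    apply/funext => x; apply/propext; split.
      move=> [Ax ex xe]; split=> //; split=> /=.
        by rewrite -[_ *m _]/(_ * _) mulrBl mul1r ex subrr.
      by rewrite -[_ *m _]/(_ * _) mulrBr mulr1 xe subrr.
    move=> [Ax [/= ex xe]]; split=> //; apply/esym/eqP; rewrite -subr_eq0; apply/eqP.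
      by rewrite -[RHS]ex -[_ *m _]/(_ * _) mulrBl mul1r.
    by rewrite -[RHS]xe -[_ *m _]/(_ * _) mulrBr mulr1.
  by apply: zclosedI => //; apply: zclosedI; apply: zclosed_kernel.
by exists (FieldSubring (closed_division_comm clD)).
Qed.

(** Two primitive idempotents are linked when [e l * A * e k] is nonzero; by
    [primitive_invertible] this is an equivalence relation.  The map [c] picks a
    representative of each class, and [u l], [v l] are inverse isomorphisms between
    [e l] and [e (c l)]. *)
Lemma primitive_classes r (e : 'I_r -> M) : (forall i, primitive_idempotent A (e i)) ->
  exists (c : 'I_r -> 'I_r) (u v : 'I_r -> M),
  [/\ forall l, c (c l) = c l,
      forall l, [/\ A (u l), e l * u l = u l & u l * e (c l) = u l],
      forall l, [/\ A (v l), e (c l) * v l = v l & v l * e l = v l],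
      forall l, v l * u l = e (c l) /\ u l * v l = e l &
      forall l m, c l != c m -> forall x, A x -> e l * x * e m = 0].
Proof.
move=> prim; pose rel l k := exists2 x, A x & e l * x * e k != 0.
have inv l k y : A y -> y != 0 -> e l * y = y -> y * e k = y ->
    exists v, [/\ A v, e k * v = v, v * e l = v, v * y = e k & y * v = e l].
  exact: (primitive_invertible srA clA spA (prim k) (prim l)).
have Ae l : A (e l) by case: (prim l).
have ee l : e l * e l = e l by case: (prim l).
have e0 l : e l != 0 by case: (prim l).
have corner l k x : A x -> [/\ A (e l * x * e k), e l * (e l * x * e k) = e l * x * e k &
    e l * x * e k * e k = e l * x * e k].
  move=> Ax; split; [by apply: (AM) => //; apply: AM|by rewrite !mulrA ee|].
  by rewrite -mulrA ee.
have rel_refl l : rel l l by exists (e l); rewrite ?ee.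
have rel_sym l k : rel l k -> rel k l.
  case=> x Ax nz; have [Ay ey ye] := corner l k x Ax.
  have [v [Av ev ve vy _]] := inv l k _ Ay nz ey ye.
  exists v => //; rewrite ev ve; apply: contraNneq (e0 k) => v0.
  by rewrite -vy v0 mul0r.
have rel_trans l k m : rel l k -> rel k m -> rel l m.
  case=> x Ax nzx [z Az nzz]; have [Ay ey ye] := corner l k x Ax.
  have [Aw ew we] := corner k m z Az.
  have [v [Av ev ve vy _]] := inv l k _ Ay nzx ey ye.
  exists (e l * x * e k * (e k * z * e m)); first exact: AM.
  rewrite [e l * (_ * _)]mulrA ey -[_ * _ * e m]mulrA we.
  by apply: contraNneq nzz => E; rewrite -ew -{1}vy -[v * _ * _]mulrA E mulr0.
pose c l := odflt l [pick k | `[< rel l k >]].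
have relc l : rel l (c l).
  by rewrite /c; case: pickP => [k /asboolP|].
have relE l m : rel l m -> c l = c m.
  move=> lm; rewrite /c (@eq_pick _ _ [pred k | `[< rel m k >]]) => [|k /=].
    case: pickP => // /(_ m) /asboolP []; exact: rel_refl.
  by apply/asboolP/asboolP; apply: rel_trans => //; apply: rel_sym.
have /choice [uv uvP] : forall l, exists uv : M * M,
    [/\ [/\ A uv.1, e l * uv.1 = uv.1 & uv.1 * e (c l) = uv.1],
        [/\ A uv.2, e (c l) * uv.2 = uv.2 & uv.2 * e l = uv.2] &
        uv.2 * uv.1 = e (c l) /\ uv.1 * uv.2 = e l].
  move=> l; have [x Ax nz] := relc l; have [Ay ey ye] := corner l (c l) x Ax.
  have [v [Av ev ve vy yv]] := inv l (c l) _ Ay nz ey ye.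
  by exists (e l * x * e (c l), v).
exists c, (fun l => (uv l).1), (fun l => (uv l).2); split.
- by move=> l; apply/esym/relE/relc.
- by move=> l; case: (uvP l).
- by move=> l; case: (uvP l).
- by move=> l; case: (uvP l).
move=> l m clm x Ax; apply/eqP; apply: contraNT clm => nz.
by apply/eqP/relE; exists x.
Qed.

(** The coordinates of [x] in the block of [i] are the elements [v l * x * u m] of
    the corner of the representative of [i], for [l] and [m] in its class.  The last
    clause serves to transfer scalars that preserve [A]. *)
Lemma closed_semiprime_structure :
  exists (r : nat) (d : 'I_r -> nat) (L : 'I_r -> fieldSubring M)
    (phi : forall i, M -> 'M[fs_type (L i)]_(d i)),
  (forall i, (0 < d i)%N) /\
  [/\ forall i x y, A x -> A y -> phi i (x + y) = phi i x + phi i y,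
      forall i x y, A x -> A y -> phi i (x * y) = phi i x *m phi i y,
      forall x y, A x -> A y -> (forall i, phi i x = phi i y) -> x = y,
      forall X : forall i, 'M[fs_type (L i)]_(d i),
        exists2 x, A x & forall i, phi i x = X i &
      forall c : K, (forall x, A x -> A (c *: x)) -> forall i,
        L i (c *: ds_unit (L i)) /\ forall x a b, A x ->
          val (phi i (c *: x) a b) = c *: ds_unit (L i) * val (phi i x a b)].
Proof.
have [N [e [prim orth unitE]]] := complete_orthogonal_primitives srA clA spA.
have [c [u [v [cc uP vP vuP blocks]]]] := primitive_classes prim.
have [L0 L0P] := choice (fun l => corner_field (prim l)).
pose reps := [set l | c l == l].
pose rep (i : 'I_#|reps|) : 'I_N := enum_val i.
pose cls i := [set l | c l == rep i].
pose L i := L0 (rep i).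
pose at_ i (a : 'I_#|cls i|) : 'I_N := enum_val a.
have c_at i a : c (@at_ i a) = rep i.
  by have := enum_valP a; rewrite inE => /eqP.
have LP i x : L i x <-> [/\ A x, e (rep i) * x = x & x * e (rep i) = x].
  by case: (L0P (rep i)).
have L1 i : ds_unit (L i) = e (rep i) by case: (L0P (rep i)).
have entry i l m x : c l = rep i -> c m = rep i -> A x -> L i (v l * x * u m).
  move=> cl cm Ax; have [Av ev _] := vP l; have [Au _ ue] := uP m.
  apply/LP; split; first by apply: (AM) => //; apply: AM.
    by rewrite !mulrA -cl ev.
  by rewrite -[v l * x * _ * _]mulrA -cm ue.
pose phi i (x : M) : 'M[fs_type (L i)]_(#|cls i|) :=
  \matrix_(a, b) insubd (0 : fs_type (L i)) (v (at_ i a) * x * u (at_ i b)).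
have phiE i x a b : A x -> val (phi i x a b) = v (at_ i a) * x * u (at_ i b).
  move=> Ax; rewrite mxE val_insubd.
  by have /asboolT -> := entry i _ _ _ (c_at i a) (c_at i b) Ax.
have Au l : A (u l) by case: (uP l).
have Av l : A (v l) by case: (vP l).
have eu l : e l * u l = u l by case: (uP l).
have ve l : v l * e l = v l by case: (vP l).
have crep i : c (rep i) = rep i by have := enum_valP i; rewrite inE => /eqP.
have repP l : exists i, c l = rep i.
  have cl : c l \in reps by rewrite inE cc.
  by exists (enum_rank_in cl (c l)); rewrite /rep enum_rankK_in.
have atP i l : c l = rep i -> exists a, l = at_ i a.
  move=> cl; have li : l \in cls i by rewrite inE cl.
  by exists (enum_rank_in li l); rewrite /at_ enum_rankK_in.
have at_inj i : injective (at_ i) by apply: enum_val_inj.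
have vu0 l m : l != m -> v l * u m = 0.
  by move=> lm; rewrite -ve -eu mulrA -[v l * _ * _]mulrA orth // mulr0 mul0r.
have vxu0 l m x : A x -> c l != c m -> v l * x * u m = 0.
  move=> Ax clm; transitivity (v l * (e l * x * e m) * u m).
    by rewrite !mulrA ve -(mulrA _ (e m)) eu.
  by rewrite blocks // mulr0 mul0r.
have sum_cls i (F : 'I_N -> M) : (forall l, c l != rep i -> F l = 0) ->
    \sum_l F l = \sum_a F (at_ i a).
  move=> F0; rewrite (bigID (mem (cls i))) /= [X in _ + X]big1 ?addr0 => [|l].
    exact: big_enum_val.
  by rewrite inE => /F0.
have val_sum i (I : finType) (F : I -> fs_type (L i)) :
    val (\sum_t F t) = \sum_t val (F t) :> M.
  exact: (@big_morph _ _ (fun z : fs_type (L i) => val z : M) 0 +%R).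
exists #|reps|, (fun i => #|cls i|), L, phi; split.
  move=> i; apply/card_gt0P; exists (rep i).
  by rewrite inE crep.
split.
- move=> i x y Ax Ay; apply/matrixP => a b; apply: val_inj; rewrite phiE; last exact: AD.
  rewrite mxE; transitivity (val (phi i x a b) + val (phi i y a b)) => //.
  by rewrite !phiE // mulrDr mulrDl.
- move=> i x y Ax Ay; apply/matrixP => a b; apply: val_inj; rewrite phiE; last exact: AM.
  rewrite mxE val_sum.
  transitivity (\sum_l (v (at_ i a) * x * u l) * (v l * y * u (at_ i b))).
    rewrite -[in LHS](unitE y Ay).1 mulr_suml mulr_sumr mulr_sumr mulr_suml.
    by apply: eq_bigr => l _; rewrite -(vuP l).2 !mulrA.
  rewrite (sum_cls i) => [|l cl].
    by apply: eq_bigr => l _; rewrite -!phiE.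
  by rewrite vxu0 ?mul0r // c_at eq_sym.
- move=> x y Ax Ay xy; rewrite -(unitE x Ax).1 -(unitE y Ay).1.
  rewrite -[in LHS](unitE x Ax).2 -[in RHS](unitE y Ay).2.
  rewrite !mulr_suml; apply: eq_bigr => l _; rewrite !mulr_sumr; apply: eq_bigr => m _.
  rewrite !mulrA; have [clm|clm] := eqVneq (c l) (c m); last by rewrite !blocks.
  have [i ci] := repP l; have [a lE] := atP i l ci.
  have [b mE] := atP i m (etrans (esym clm) ci).
  have E : v l * x * u m = v l * y * u m by rewrite lE mE -!phiE // xy.
  have sandwich z : e l * z * e m = u l * (v l * z * u m) * v m.
    by rewrite -(vuP l).2 -(vuP m).2 !mulrA.
  by rewrite !sandwich E.
- move=> X.
  pose x := \sum_i \sum_a \sum_b u (at_ i a) * val (X i a b) * v (at_ i b).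
  have AX i a b : A (val (X i a b)) by have /LP [] := ds_valP (X i a b).
  have Asum (I : finType) (F : I -> M) : (forall t, A (F t)) -> A (\sum_t F t).
    by move=> AF; elim/big_ind: _ => //; case: srA.
  have Ax : A x.
    by do 3!(apply: (Asum) => ?); apply: (AM) => //; apply: AM.
  exists x => //.
  move=> i; apply/matrixP => a b; apply: val_inj; rewrite phiE //.
  have dist j a' : j != i -> at_ j a' != at_ i a.
    by apply: contraNneq => E; apply/eqP/enum_val_inj; rewrite -/(rep j) -(c_at j a') E c_at.
  rewrite /x mulr_sumr mulr_suml (bigD1 i) //= [X in _ + X]big1 ?addr0 => [|j ji]; last first.
    rewrite mulr_sumr mulr_suml big1 // => a' _; rewrite mulr_sumr mulr_suml big1 // => b' _.
    by rewrite !mulrA vu0 ?mul0r // eq_sym dist.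
  rewrite mulr_sumr mulr_suml (bigD1 a) //= [X in _ + X]big1 ?addr0 => [|a' aa']; last first.
    rewrite mulr_sumr mulr_suml big1 // => b' _.
    by rewrite !mulrA vu0 ?mul0r // eq_sym (inj_eq (at_inj i)).
  rewrite mulr_sumr mulr_suml (bigD1 b) //= [X in _ + X]big1 ?addr0 => [|b' bb']; last first.
    by rewrite -!mulrA vu0 ?mulr0 // (inj_eq (at_inj i)).
  have /LP [_ eX Xe] := ds_valP (X i a b).
  rewrite !mulrA (vuP _).1 c_at eX -mulrA (vuP _).1 c_at; exact: Xe.
move=> s As i; split.
  rewrite L1; have [Ae _ ee _] := prim (rep i); apply/LP; split; first exact: As.
    by rewrite -scalerAr ee.
  by rewrite -scalerAl ee.
move=> x a b Ax; rewrite !phiE //; last exact: As.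
have /LP [_ ex _] := entry i _ _ x (c_at i a) (c_at i b) Ax.
by rewrite L1 -scalerAl ex -scalerAr -scalerAl.
Qed.

End MatrixUnits.

(** * Embedding into a matrix algebra *)

Section RegularRepresentation.
Variables (K : fieldType) (B : vectType K) (mul : {bilinear B -> B -> B}).
Hypothesis mulA : associative mul.
Variables (n : nat) (b : n.-tuple B).
Hypothesis b_base : basis_of fullv b.
Local Notation M := 'M[K]_n.+1.

Let mulDr x y z : mul z (x + y) = mul z x + mul z y. Proof. exact: linearDr. Qed.
Let mulZl c x z : mul (c *: x) z = c *: mul x z. Proof. exact: linearZl_LR. Qed.
Let mulZr c x z : mul z (c *: x) = c *: mul z x. Proof. exact: linearZr_LR. Qed.

Let coord_sum x : x = \sum_i coord b i x *: b`_i.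
Proof. exact: coord_basis b_base (memvf x). Qed.

Let row_of (x : B) : 'rV[K]_n := \row_i coord b i x.
Let right_mx (x : B) : 'M[K]_n := \matrix_(i, j) coord b j (mul b`_i x).

(** Right multiplication by [x] on [K + B], in the basis formed by the adjoined unit
    and [b]; the first row records [x] itself, which makes the map injective. *)
Definition regular_mx (x : B) : M := block_mx (0 : 'M_1) (row_of x) 0 (right_mx x).

Definition regular_vec (Y : M) : B :=
  \sum_i Y ord0 (rshift 1 i : 'I_n.+1) *: b`_i.

Lemma regular_vecK : cancel regular_mx regular_vec.
Proof.
move=> x; rewrite [RHS]coord_sum; apply: eq_bigr => i _.
have E : block_mx (0 : 'M_1) (row_of x) 0 (right_mx x) (lshift n 0) (rshift 1 i) = coord b i x.
  by rewrite block_mxEur mxE.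
rewrite -E /regular_mx; congr (fun_of_matrix _ _ _ *: _); exact: val_inj.
Qed.

Lemma regular_mx_linear : linear regular_mx.
Proof.
move=> c x y; transitivity (c *: (block_mx 0 (row_of x) 0 (right_mx x) : 'M_(1 + n))
  + block_mx 0 (row_of y) 0 (right_mx y)) => //.
rewrite scale_block_mx add_block_mx !scaler0 !addr0.
apply: (f_equal2 (fun u v => block_mx (0 : 'M_1) u 0 v)).
  by apply/rowP => i; rewrite !mxE linearP.
by apply/matrixP => i j; rewrite !mxE mulDr mulZr linearP.
Qed.

Lemma regular_vec_linear : linear regular_vec.
Proof.
move=> c X Y; rewrite /regular_vec scaler_sumr -big_split; apply: eq_bigr => i _.
by rewrite !mxE scalerDl scalerA.
Qed.

Let row_ofM x y : row_of x *m right_mx y = row_of (mul x y).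
Proof.
apply/rowP => j; rewrite !mxE [in RHS](coord_sum x) linear_sumlz raddf_sum.
by apply: eq_bigr => i _; rewrite !mxE mulZl; exact: (esym (linearZ_LR (coord b j) _ _)).
Qed.

Lemma regular_mxM x y : regular_mx (mul x y) = regular_mx x * regular_mx y.
Proof.
transitivity ((block_mx 0 (row_of x) 0 (right_mx x) : 'M_(1 + n)) *m
  (block_mx 0 (row_of y) 0 (right_mx y) : 'M_(1 + n))) => //.
rewrite mulmx_block !mulmx0 !mul0mx !addr0 !add0r row_ofM.
apply: (f_equal (fun v => block_mx (0 : 'M_1) _ 0 v)); apply/row_matrixP => i; rewrite row_mul.
have rowE z : row i (right_mx z) = row_of (mul b`_i z) by apply/rowP => j; rewrite !mxE.
by rewrite !rowE row_ofM mulA.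
Qed.

End RegularRepresentation.

Lemma polyfun_meval (K : fieldType) (V : lmodType K) n (l : 'I_n -> V -> K)
    (p : {mpoly K[n]}) :
  (forall i, polyfun (l i)) -> polyfun (fun x => p.@[fun i => l i x]).
Proof.
move=> pl.
have ext f g : f =1 g -> polyfun f -> polyfun g by move=> /funext ->.
have pX i k : polyfun (fun x => l i x ^+ k).
  elim: k => [|k IH]; first exact: polyfun_const.
  by apply: ext (polyfunM (pl i) IH) => x; rewrite exprS.
have pP (s : seq 'I_n) (m : 'X_{1..n}) : polyfun (fun x => \prod_(i <- s) l i x ^+ m i).
  elim: s => [|i s IH].
    by apply: ext (polyfun_const V 1) => x; rewrite big_nil.
  by apply: ext (polyfunM (pX i (m i)) IH) => x; rewrite big_cons.
have pS (s : seq 'X_{1..n}) :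
    polyfun (fun x => \sum_(m <- s) p@_m * \prod_i l i x ^+ m i).
  elim: s => [|m s IH].
    by apply: ext (polyfun_const V 0) => x; rewrite big_nil.
  apply: ext (polyfunD (polyfunM (polyfun_const V p@_m) (pP _ m)) IH) => x.
  by rewrite big_cons.
by apply: ext (pS (msupp p)) => x; rewrite mevalE.
Qed.

Lemma zariski_closed_zclosed (K : fieldType) (B : vectType K) n (b : n.-tuple B)
  (A : set B) : zariski_closed b A -> zclosed A.
Proof.
case=> S ->; move=> x xcl p Sp /=.
apply: (xcl (fun y => p.@[fun i => coord b i y])) => [|y]; last by apply.
apply: polyfun_meval => i; apply: polyfun_linear => c u v; exact: linearP.
Qed.

Section SemiprimeElements.
Variables (F K : fieldType) (iota : {rmorphism F -> K}).
Variables (B : vectType K) (mul : {bilinear B -> B -> B}) (mulA : associative mul).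
Variable A : set B.
Hypotheses (A_sub : subalgebraF iota mul A) (A_semiprime : semiprimeF iota mul A).

(** Let [R] be the right annihilator of [a * A], and [L] the left annihilator of
    [A * R].  Both are two-sided ideals of [A], and the cube of their intersection
    is 0.  If [a * A * a = 0], then [a] lies in it. *)
Lemma semiprime_element a : A a -> (forall x, A x -> mul (mul a x) a = 0) -> a = 0.
Proof.
move=> Aa aAa; have [[A0 AD AZ] AM] := A_sub.
pose R := [set y | A y /\ forall x, A x -> mul (mul a x) y = 0]%classic.
pose L := [set y | A y /\ forall x z, A x -> R z -> mul (mul y x) z = 0]%classic.
have RL : two_sided_ideal iota mul A (R `&` L)%classic.
  split.
  - by move=> y [[]].
  - split.
    + split; split=> //; first by move=> x _; rewrite linear0r.
      by move=> x z _ _; rewrite !linear0l.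
    + move=> y z [[Ay Ry] [_ Ly]] [[Az Rz] [_ Lz]]; split; split; try exact: AD.
        by move=> x Ax; rewrite linearDr /= Ry // Rz // addr0.
      by move=> x w Ax Rw; rewrite !linearDl /= Ly // Lz // addr0.
    + move=> c y [[Ay Ry] [_ Ly]]; split; split; try exact: AZ.
        by move=> x Ax; rewrite linearZr_LR /= Ry // scaler0.
      by move=> x w Ax Rw; rewrite !linearZl_LR /= Ly // scaler0.
  - move=> c y Ac [[Ay Ry] [_ Ly]]; split; split; try exact: AM.
      by move=> x Ax; rewrite mulA -(mulA a) Ry //; apply: AM.
    by move=> x w Ax Rw; rewrite -!mulA [mul y _]mulA Ly // linear0r.
  - move=> c y Ac [[Ay Ry] [_ Ly]]; split; split; try exact: AM.
      by move=> x Ax; rewrite mulA Ry // linear0l.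
    by move=> x w Ax Rw; rewrite -(mulA y) Ly //; apply: AM.
have nil : nilpotent_set mul (R `&` L)%classic.
  exists 2 => x [|y [|z []]] //= _ [_ [_ Lx]] RLs.
  have [[Ay _] _] := RLs y (mem_head _ _).
  have [Rz _] := RLs z (mem_last y [:: z]).
  by apply: Lx.
have : (R `&` L)%classic a.
  split; split=> // x z Ax [_ Rz]; exact: Rz.
by rewrite (A_semiprime RL nil).
Qed.

End SemiprimeElements.

Lemma scalar_embedding (F K : fieldType) (iota : {rmorphism F -> K}) n
  (D : fieldSubring 'M[K]_n.+1) : (forall a, D (iota a *: ds_unit D)) ->
  exists emb : {rmorphism F -> fs_type D},
    forall a, val (emb a) = iota a *: ds_unit D.
Proof.
move=> De; pose f a : fs_type D := ds_mk (De a).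
have De1 : D (ds_unit D) := ds_unitP D.
have fB : zmod_morphism f.
  by move=> a c; apply: ds_ext; rewrite /= rmorphB scalerBl.
have fM : monoid_morphism f.
  split; first by apply: ds_ext; rewrite /= rmorph1 scale1r.
  move=> a c; apply: ds_ext; rewrite /= rmorphM -scalerAl -scalerAr ds_mul1 //.
  by rewrite scalerA.
pose emb : {rmorphism F -> fs_type D} :=
  HB.pack f (GRing.isZmodMorphism.Build _ _ f fB) (GRing.isMonoidMorphism.Build _ _ f fM).
by exists emb.
Qed.

(** * The structure theorem *)

Theorem theorem3p28 (F : fieldType) (K : closedFieldType)
    (iota : {rmorphism F -> K})
    (B : vectType K) (mul : {bilinear B -> B -> B}) (mulA : associative mul)
    (n : nat) (e : n.-tuple B) (e_base : basis_of fullv e)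
    (A : set B) (A_sub : subalgebraF iota mul A)
    (A_closed : zariski_closed e A) (A_semiprime : semiprimeF iota mul A) :
  semisimpleF iota mul A.
Proof.
have [[A0 AD AZ] AM] := A_sub.
pose rho : {linear B -> 'M[K]_n.+1} := HB.pack (regular_mx mul e)
  (GRing.isLinear.Build _ _ _ _ _ (regular_mx_linear mul e)).
pose vec : {linear 'M[K]_n.+1 -> B} := HB.pack (@regular_vec K B n e)
  (GRing.isLinear.Build _ _ _ _ _ (@regular_vec_linear K B n e)).
have rhoK : cancel rho vec by apply: regular_vecK.
have rhoM x y : rho (mul x y) = rho x * rho y by apply: regular_mxM.
pose A' := [set X | A (vec X) /\ X = rho (vec X)]%classic.
have A'rho x : A x -> A' (rho x) by move=> Ax; split; rewrite rhoK.
have srA' : subrng A'.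
  split.
  - by rewrite -(linear0 rho); apply: A'rho.
  - move=> X Y [AX ->] [AY ->]; rewrite -linearB; apply: A'rho.
    by rewrite -scaleN1r -(rmorphN1 iota); apply: (AD) => //; apply: AZ.
  - by move=> X Y [AX ->] [AY ->]; rewrite -rhoM; apply/A'rho/AM.
have clA' : zclosed A'.
  pose h X := X - rho (vec X).
  have hlin : linear h.
    by move=> c X Y; rewrite /h [vec _]linearP [rho _]linearP scalerBr opprD addrACA.
  pose hL : {linear 'M[K]_n.+1 -> 'M[K]_n.+1} :=
    HB.pack h (GRing.isLinear.Build _ _ _ _ h hlin).
  have -> : A' = ([set X | A (vec X)] `&` [set X | hL X = 0])%classic.
    apply/funext => X; apply/propext; split=> -[AX hX]; split=> //=.
      by rewrite /h -hX subrr.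
    by apply/eqP; rewrite -subr_eq0; apply/eqP.
  apply: zclosedI; last exact: zclosed_kernel.
  exact: zclosed_preimage (zariski_closed_zclosed A_closed).
have spA' : semiprime_rng A'.
  move=> X [AX ->] XAX; rewrite (semiprime_element mulA A_sub A_semiprime AX) ?linear0 //.
  move=> x Ax; apply: (can_inj rhoK); rewrite !rhoM linear0.
  by apply: XAX; apply: A'rho.
have [r [d [L [phi [d0 [phiD phiM phi_inj phi_surj phiZ]]]]]] :=
  closed_semiprime_structure srA' clA' spA'.
have A'Z a X : A' X -> A' (iota a *: X).
  by move=> [AX ->]; rewrite -linearZ; apply/A'rho/AZ.
have LZ a := phiZ (iota a) (A'Z a).
pose emb i := projT1 (cid (scalar_embedding (fun a => (LZ a i).1))).
have embE i a : val (emb i a) = iota a *: ds_unit (L i).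
  exact: (projT2 (cid (scalar_embedding (fun a => (LZ a i).1)))).
exists r, d, (fun i => fs_type (L i) : fieldType), emb, (fun i x => phi i (rho x)).
split=> //; split.
- by move=> i x y Ax Ay; rewrite linearD phiD //; apply: A'rho.
- move=> i a x Ax; apply/matrixP => k l; apply: val_inj.
  rewrite linearZ (LZ a i).2; last exact: A'rho.
  by rewrite [in RHS]mxE -embE.
- by move=> i x y Ax Ay; rewrite rhoM phiM //; apply: A'rho.
- move=> x y Ax Ay E; apply: (can_inj rhoK); apply: phi_inj => //; exact: A'rho.
move=> X; have [Y [AY ->] YE] := phi_surj X.
by exists (vec Y).
Qed.
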